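(* Let $d>0$, $d\in\mathbb{Q}$, $\sqrt d\notin\mathbb{Q}$. Let $A,B,C$ be trapezoids of height $1$, all of whose bases are parallel to one fixed line, each having both angles at its larger base equal to $45^\circ$, and let the lengths of their midlines be $a,b,c$ respectively. Suppose $a,b\in\mathbb{Q}[\sqrt d]$, $\overline a>0$ and $\overline b<0$. Then $C$ can be tiled by trapezoids each of which is homothetic to $A$ or to $B$ if and only if $c\in\mathbb{Q}[\sqrt d]$.
   Context: $\mathbb{Q}[\sqrt d]$ is the set of real numbers $u+v\sqrt d$ with $u,v\in\mathbb{Q}$; for $x=u+v\sqrt d$ with $u,v\in\mathbb{Q}$, the conjugate is $\overline x=u-v\sqrt d$. A trapezoid is a quadrilateral with exactly one pair of parallel sides; these are its bases, and its midline has length equal to half the sum of the lengths of the bases. A figure is homothetic to another if it is its image under a map $z\mapsto \lambda z+w$ of the plane with real $\lambda\neq 0$ (negative $\lambda$ allowed) and $w\in\mathbb{R}^2$. A tiling of a figure is a representation of it as a finite union of figures (tiles) with pairwise disjoint interiors. *)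

(* Defs.v *)
From mathcomp Require Import all_boot all_order all_algebra.
From mathcomp Require Import all_classical all_reals all_analysis.
Set Implicit Arguments.
Unset Strict Implicit.
Unset Printing Implicit Defensive.
Import Order.TTheory GRing.Theory Num.Theory.
Import numFieldNormedType.Exports.
Local Open Scope classical_set_scope.
Local Open Scope ring_scope.

Definition quadfield (R : realType) (d : rat) : set R :=
  [set x | exists u v : rat, x = ratr u + ratr v * Num.sqrt (ratr d)].

(* The value 0 is used only when x is not in quadfield R d; the conjugate is
   unique when sqrt d is irrational, see quadconjE. *)
Definition quadconj (R : realType) (d : rat) (x : R) : R :=
  xget 0 [set y | exists u v : rat,
    x = ratr u + ratr v * Num.sqrt (ratr d) /\
    y = ratr u - ratr v * Num.sqrt (ratr d)].

Lemma quadconjE (R : realType) (d : rat) (u v : rat) :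
  (forall r : rat, Num.sqrt (ratr d) <> ratr r :> R) ->
  quadconj d (ratr u + ratr v * Num.sqrt (ratr d) : R)
    = ratr u - ratr v * Num.sqrt (ratr d).
Proof.
move=> irr; rewrite /quadconj; case: xgetP; last first.
  by move=> /(_ (ratr u - ratr v * Num.sqrt (ratr d))) []; exists u, v.
move=> y _ [u' [v' [e ->]]].
have e2 : ratr (v - v') * Num.sqrt (ratr d) = ratr (u' - u) :> R.
  rewrite (rmorphB _ v) (rmorphB _ u') mulrBl; apply/eqP.
  by rewrite subr_eq addrAC -e addrAC subrr add0r.
have /eqP vv : v - v' == 0.
  apply/negPn/negP => nz; apply: (irr ((v - v')^-1 * (u' - u))).
  by rewrite rmorphM fmorphV /= -e2 mulKf // fmorph_eq0.
move: e2; rewrite vv rmorph0 mul0r => /esym/eqP.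
by rewrite fmorph_eq0 subr_eq0 => /eqP ->; move/subr0_eq: vv => ->.
Qed.

Notation plane R := (R * R)%type.

Section PlaneGeometry.
Variable R : realType.
Implicit Types (p q r u v : plane R) (F : set (plane R)).

Definition dot u v : R := u.1 * v.1 + u.2 * v.2.

(* The canonical norm on R * R is the max norm. *)
Definition enorm u : R := Num.sqrt (dot u u).

Definition parallel u v : Prop := u.1 * v.2 = u.2 * v.1.

Definition angle p q r : R :=
  acos (dot (p - q) (r - q) / (enorm (p - q) * enorm (r - q))).

Definition segment p q : set (plane R) :=
  [set (1 - t) *: p + t *: q | t in `[0, 1]].

(* Orthogonal projection of r to the line through p and q *)
Definition foot p q r : plane R :=
  p + (dot (r - p) (q - p) / dot (q - p) (q - p)) *: (q - p).

Definition homothetic F G : Prop :=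
  exists (l : R) (w : plane R), l != 0 /\ F = (fun z => l *: z + w) @` G.

Definition tiled_by (P : set (set (plane R))) F : Prop :=
  exists (n : nat) (T : 'I_n -> set (plane R)),
    [/\ forall i, P (T i),
        forall i j, i != j -> (T i)° `&` (T j)° = set0
      & F = \bigcup_i T i].

(* Vertices are listed in cyclic order. *)
Record vertices4 := Vertices4 { vx0 : plane R; vx1 : plane R;
                                vx2 : plane R; vx3 : plane R }.
Implicit Type T : vertices4.

(* A simple closed broken line: no two adjacent sides are collinear and
   opposite sides do not meet. *)
Definition is_quadrilateral T : Prop :=
  let: Vertices4 p0 p1 p2 p3 := T in
  [/\ [/\ ~ parallel (p1 - p0) (p2 - p1), ~ parallel (p2 - p1) (p3 - p2),
          ~ parallel (p3 - p2) (p0 - p3) & ~ parallel (p0 - p3) (p1 - p0)],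
      segment p0 p1 `&` segment p2 p3 = set0
    & segment p1 p2 `&` segment p3 p0 = set0].

(* Labelling convention: the bases are [vx0, vx1] and [vx2, vx3], the first one
   being the larger.  The bases of a trapezoid are never of equal length, so
   every trapezoid can be labelled in this way. *)
Definition is_trapezoid T : Prop :=
  [/\ is_quadrilateral T,
      parallel (vx1 T - vx0 T) (vx3 T - vx2 T),
      ~ parallel (vx2 T - vx1 T) (vx0 T - vx3 T)
    & enorm (vx3 T - vx2 T) < enorm (vx1 T - vx0 T)].

(* The convex hull of the vertices, which is the plane figure bounded by the
   sides because trapezoids are convex. *)
Definition figure T : set (plane R) :=
  [set z | exists t0 t1 t2 t3 : R,
    [/\ [/\ 0 <= t0, 0 <= t1, 0 <= t2 & 0 <= t3],
        t0 + t1 + t2 + t3 = 1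
      & z = t0 *: vx0 T + t1 *: vx1 T + t2 *: vx2 T + t3 *: vx3 T]].

Definition height T : R := enorm (vx2 T - foot (vx0 T) (vx1 T) (vx2 T)).

Definition midline T : R :=
  (enorm (vx1 T - vx0 T) + enorm (vx3 T - vx2 T)) / 2.

Definition trapezoid45 u T : Prop :=
  [/\ is_trapezoid T,
      parallel (vx1 T - vx0 T) u,
      height T = 1,
      angle (vx1 T) (vx0 T) (vx3 T) = pi / 4
    & angle (vx0 T) (vx1 T) (vx2 T) = pi / 4].

End PlaneGeometry.

(* Main.v *)
Require Import Defs.
From mathcomp Require Import all_boot all_order all_algebra.
From mathcomp Require Import all_classical all_reals all_analysis.
From mathcomp Require Import ring lra.
Import Order.TTheory GRing.Theory Num.Theory.
Import numFieldNormedType.Exports.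
Local Open Scope classical_set_scope.
Local Open Scope ring_scope.

(** Choose an orthonormal frame whose first vector [e] is parallel to the bases.
Up to a translation and a change of sign, a trapezoid of height 1 with base
angles of 45 degrees is then the normal trapezoid [std_trapezoid e m]
determined by its midline [m > 1] ([trapezoid45_std]), so every tile is [tile e k w m], the
image of a normal trapezoid under [z |-> k z + w].

Tiling implies membership.  Let [K] be the quadratic field.  The indicator
function of a tile determines its four vertices, with sign + at the ends of the
larger base and - at the ends of the smaller one: a fixed combination of its
values at six points close to [z] vanishes unless [z] is a vertex, and then
gives the sign ([probe_tile]).  In a tiling the indicators of the tiles add up
to that of the big trapezoid off the sides, hence the signed sums of any
function over the vertices add up as well ([tiling_vertices]).  Apply this to
the square of [f(x)], where [x] is the first coordinate and [f] is [K]-linear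
on the [K]-span of all the numbers in play.  A tile of ratio [k] contributes
[2 f(k) f(k m)], an algebraic substitute for twice its area, which is
[2 m f(k)^2 >= 0] as soon as [m] is in [K].  If [c] were not in [K], one could
take [f 1 = 1] and [f c = -1] ([separating_functional]), and the big trapezoid
would contribute [-2] ([tiling_ratio]).

Membership implies tiling.  Say that [r > 0] is good if the tiles fill
parallelograms of height [h] and base [r h], with angle 45 degrees.  Two copies
of a trapezoid, one upside down, show that [2a] and [2b] are good.  Good numbers
are closed under addition (juxtaposition), and their inverses too (stacking),
hence also under multiplication by positive rationals.  Plot [x] in [K] as the
point [(x, conj x)]: the cone generated by [a] and [b] contains all directions
close to the horizontal axis, on both sides, since [conj a > 0 > conj b].
Taking inverses turns these into the directions close to the vertical axis, and
every positive element of [K] is a sum of two positive elements with such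
directions; so all positive elements of [K] are good ([good_all]).  A trapezoid
of midline larger than [a] is a trapezoid of midline [a] and a parallelogram,
and horizontal cuts into sufficiently many equal strips make all strips long
enough for this ([tiled_tile]). *)

Set Implicit Arguments.
Unset Strict Implicit.
Unset Printing Implicit Defensive.

(** * Trapezoids in an adapted frame *)

Definition perp (R : realType) (e : plane R) : plane R := (- e.2, e.1).

(** Its larger base has length [m + 1] and is centred at the origin; the smaller
one has length [m - 1]. *)
Definition std_trapezoid (R : realType) (e : plane R) (m : R) : set (plane R) :=
  [set z | 0 <= dot z (perp e) <= 1 /\
           `|dot z e| <= (m + 1) / 2 - dot z (perp e)].

Definition frame {R : realType} (e : plane R) (x y : R) : plane R :=
  x *: e + y *: perp e.

Lemma dotD (R : realType) (u v w : plane R) : dot (u + v) w = dot u w + dot v w.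
Proof. by rewrite /dot /=; ring. Qed.

Lemma dotZ (R : realType) (k : R) (u w : plane R) : dot (k *: u) w = k * dot u w.
Proof. by rewrite /dot /=; rewrite /GRing.scale /=; ring. Qed.

Lemma dotB (R : realType) (u v w : plane R) : dot (u - v) w = dot u w - dot v w.
Proof. by rewrite /dot /=; ring. Qed.

Section Frame.
Variables (R : realType) (e : plane R).
Hypothesis e1 : dot e e = 1.
Implicit Types x y k : R.

Lemma frameD x y x' y' : frame e x y + frame e x' y' = frame e (x + x') (y + y').
Proof. by rewrite /frame !scalerDl addrACA. Qed.

Lemma frameB x y x' y' : frame e x y - frame e x' y' = frame e (x - x') (y - y').
Proof. by rewrite /frame !scalerBl opprD addrACA. Qed.

Lemma frameZ k x y : k *: frame e x y = frame e (k * x) (k * y).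
Proof. by rewrite /frame scalerDr !scalerA. Qed.

Lemma frameE z : z = frame e (dot z e) (dot z (perp e)).
Proof.
case: z => z1 z2; move: e1; case: e => a b; rewrite /frame /dot /= => h.
congr (_, _); rewrite /= /GRing.scale /=.
  transitivity (z1 * (a * a + b * b)); first by rewrite h mulr1.
  by ring.
transitivity (z2 * (a * a + b * b)); first by rewrite h mulr1.
by ring.
Qed.

Lemma dot_frame x y x' y' :
  dot (frame e x y) (frame e x' y') = x * x' + y * y'.
Proof.
have -> : dot (frame e x y) (frame e x' y') = (x * x' + y * y') * dot e e.
  by rewrite /frame /dot /= /GRing.scale /=; ring.
by rewrite e1 mulr1.
Qed.

Lemma frame_e : e = frame e 1 0.
Proof. by rewrite /frame scale1r scale0r addr0. Qed.

Lemma frame_perp : perp e = frame e 0 1.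
Proof. by rewrite /frame scale1r scale0r add0r. Qed.

Lemma dot_frame_e x y : dot (frame e x y) e = x.
Proof. by rewrite {2}frame_e dot_frame mulr1 mulr0 addr0. Qed.

Lemma dot_frame_perp x y : dot (frame e x y) (perp e) = y.
Proof. by rewrite {1}frame_perp dot_frame mulr1 mulr0 add0r. Qed.

Lemma enorm_frame x y : enorm (frame e x y) = Num.sqrt (x * x + y * y).
Proof. by rewrite /enorm dot_frame. Qed.

Lemma parallel_frame x y x' y' :
  parallel (frame e x y) (frame e x' y') <-> x * y' = y * x'.
Proof.
have E : (frame e x y).1 * (frame e x' y').2 - (frame e x y).2 * (frame e x' y').1
   = (x * y' - y * x') * dot e e.
  by rewrite /frame /dot /= /GRing.scale /=; ring.
rewrite e1 mulr1 in E; rewrite /parallel.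
by split => /eqP; rewrite -subr_eq0 ?E -?E => h; apply/eqP; rewrite -subr_eq0 ?E -?E.
Qed.

End Frame.

Lemma sqr_cos_pi4 (R : realType) : (cos (pi / 4 : R)) ^+ 2 * 2 = 1.
Proof.
have h : sin (pi / 4 : R) = cos (pi / 4).
  have := tan_piquarter R; rewrite /tan => t.
  have nz : cos (pi / 4 : R) != 0.
    by apply/eqP => z; move: t; rewrite z invr0 mulr0 => /eqP; rewrite eq_sym oner_eq0.
  by rewrite -[LHS](mulfVK nz) t mul1r.
by have E := cos2Dsin2 (pi / 4 : R); rewrite -[RHS]E h; ring.
Qed.

Lemma cos_pi4_gt0 (R : realType) : 0 < cos (pi / 4 : R).
Proof. by apply: cos_gt0_pihalf; have := pi_gt0 R; move=> ?; apply/andP; split; lra. Qed.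

(** In the frame, the edges at a base angle are [(L, 0)] and [(g, h)] with
[h ^ 2 = 1]: the cosine determines [g ^ 2 = 1], and its sign that of [L * g]. *)
Lemma angle45_slope (R : realType) (L g : R) : L != 0 ->
  acos (L * g / (Num.sqrt (L * L) * Num.sqrt (g * g + 1))) = pi / 4 ->
  g = Num.sg L.
Proof.
move=> L0; rewrite -expr2 sqrtr_sqr.
set S := Num.sqrt _.
have S2 : S ^+ 2 = g * g + 1 by rewrite sqr_sqrtr //; have := sqr_ge0 g; rewrite expr2; lra.
have S0 : 0 < S by rewrite sqrtr_gt0; have := sqr_ge0 g; rewrite expr2; lra.
have -> : L * g / (`|L| * S) = Num.sg L * g / S.
  rewrite {1}[L]numEsg; have : `|L| != 0 by rewrite normr_eq0.
  by move=> ?; field; rewrite gt_eqF.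
have sg2 : Num.sg L * Num.sg L = 1 by rewrite -expr2 sqr_sg L0.
set s := Num.sg L in sg2 *.
set q := s * g / S => hq.
have q2 : q ^+ 2 * (g * g + 1) = g * g.
  rewrite /q expr_div_n S2 mulfVK; last by rewrite -S2 expf_neq0 // gt_eqF.
  by transitivity ((s * s) * (g * g)); [ring | rewrite sg2 mul1r].
have qle : -1 <= q <= 1.
  have := sqr_ge0 g; rewrite expr2 => ?.
  have : q ^+ 2 <= 1 by nra.
  by rewrite -real_normK ?num_real // expr_le1 // ler_norml.
have qc : cos (pi / 4) = q by rewrite -hq acosK // in_itv /=.
have cs := @sqr_cos_pi4 R; have c0 := @cos_pi4_gt0 R.
rewrite qc in cs c0.
have gg : g * g = 1 by nra.
have sg0 : 0 < s * g by have i0 : 0 < S^-1 by [rewrite invr_gt0]; rewrite -(pmulr_lgt0 _ i0).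
have : (s * g) ^+ 2 = 1 by transitivity ((s * s) * (g * g)); [ring | rewrite sg2 gg mulr1].
move=> /eqP; rewrite sqrf_eq1 => /orP [] /eqP h; last by move: sg0; rewrite h; lra.
by rewrite -[g]mul1r -sg2 -mulrA h mulr1.
Qed.

Section Trapezoid45.
Variables (R : realType) (e : plane R).
Hypothesis e1 : dot e e = 1.

(** The sign [s] orients the larger base and [H] tells on which side the smaller
one lies. Both signs may differ because a normal trapezoid is symmetric about
the perpendicular axis, so only [H] remains in the homothety. *)
Lemma figure_std (p0 : plane R) (s H m : R) :
  s ^+ 2 = 1 -> H ^+ 2 = 1 -> 1 < m ->
  figure (Vertices4 p0 (p0 + frame e (s * (m + 1)) 0)
      (p0 + frame e (s * m) H) (p0 + frame e s H))
  = (fun z => H *: z + (p0 + frame e (s * (m + 1) / 2) 0)) @` std_trapezoid e m.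
Proof.
move=> s2 H2 m1; rewrite predeqE => z; split => /=.
  move=> [t0 [t1 [t2 [t3 [[[h0 h1 h2 h3] t ->]]]]]].
  exists (frame e (H * s * ((t1 - t0) * ((m + 1) / 2) + (t2 - t3) * ((m - 1) / 2)))
            (t2 + t3)).
    rewrite /std_trapezoid /= dot_frame_e // dot_frame_perp // !normrM.
    have -> : `|H| = 1 by apply/eqP; rewrite -sqrp_eq1 // real_normK ?num_real // H2.
    have -> : `|s| = 1 by apply/eqP; rewrite -sqrp_eq1 // real_normK ?num_real // s2.
    split; first by apply/andP; split; lra.
    by rewrite !mul1r ler_norml; apply/andP; split; nra.
  have -> : t0 = 1 - t1 - t2 - t3 by lra.
  rewrite frameZ addrCA frameD.
  have -> : H * (H * s * ((t1 - (1 - t1 - t2 - t3)) * ((m + 1) / 2) +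
     (t2 - t3) * ((m - 1) / 2))) + s * (m + 1) / 2 = H ^+ 2 * s * ((t1 - (1 - t1 - t2 - t3)) * ((m + 1) / 2) +
     (t2 - t3) * ((m - 1) / 2)) + s * (m + 1) / 2 by ring.
  rewrite H2 /frame; case: p0 => a b; case: e => u v.
  by congr (_, _); rewrite /= /GRing.scale /=; field.
move=> [z' [/andP [y0 y1]]].
move: (frameE e1 z') y0 y1.
move: (dot z' e) (dot z' (perp e)) => x y -> y0 y1; rewrite ler_norml => /andP [xl xr] <-.
have ss : s * s = 1 by rewrite -expr2.
have HH : H * H = 1 by rewrite -expr2.
pose W := (m + 1) / 2 - y.
have W0 : 0 < W by rewrite /W; lra.
(* the position of the point on its row, counted from the left *)
pose k := (1 + s * H * x / W) / 2.
have k01 : 0 <= k <= 1.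
  have : `|s * H * x / W| <= 1.
    rewrite !normrM.
    have -> : `|H| = 1 by apply/eqP; rewrite -sqrp_eq1 // real_normK ?num_real // H2.
    have -> : `|s| = 1 by apply/eqP; rewrite -sqrp_eq1 // real_normK ?num_real // s2.
    rewrite !mul1r normfV (gtr0_norm W0) ler_pdivrMr // mul1r ler_norml /W.
    by apply/andP; split; lra.
  by rewrite ler_norml /k; move: (_ / W) => q /andP [? ?]; apply/andP; split; lra.
have kE : (2 * k - 1) * W = s * H * x.
  by rewrite /k; field; rewrite gt_eqF.
case/andP: k01 => k0 k1.
exists ((1 - y) * (1 - k)), ((1 - y) * k), (y * k), (y * (1 - k)); split.
- by split; apply: mulr_ge0; lra.
- by ring.
have xE : H * x = s * ((2 * k - 1) * W).
  by rewrite kE !mulrA ss mul1r.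
rewrite frameZ xE /W /frame; case: p0 => a b; case: e => u v.
by congr (_, _); rewrite /= /GRing.scale /=; field.
Qed.

(** With edges of slope 45 degrees and height 1, the smaller base has signed
length [L - 2] if the larger one has length [L]; for [L <= 2] the lateral sides
would meet, so that the broken line would not be simple. *)
Lemma trapezoid45_std (l : plane R) (k : R) (T : vertices4 R) :
  k != 0 -> l = k *: e -> trapezoid45 l T ->
  exists (s : R) (w : plane R), [/\ s ^+ 2 = 1, 1 < midline T &
    figure T = (fun z => s *: z + w) @` std_trapezoid e (midline T)].
Proof.
move=> k0 lE; case: T => p0 p1 p2 p3 [[[[par01 _ _ _] _ seg] par23 _ lt23] /= parl hH hA hB].
rewrite /= in par01 par23 lt23.
have fr (p q : plane R) : exists x y, q = p + frame e x y.
  exists (dot (q - p) e), (dot (q - p) (perp e)).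
  by rewrite -frameE // addrC subrK.
have [L [L' p1E]] := fr p0 p1.
have [g [H p3E]] := fr p0 p3.
have [M [M' p2E]] := fr p3 p2.
have L'0 : L' = 0.
  have {}lE : l = frame e k 0 by rewrite lE /frame scale0r addr0.
  move: parl; rewrite p1E addrC addKr lE parallel_frame // mulr0 => /esym/eqP.
  by rewrite mulf_eq0 (negbTE k0) orbF => /eqP.
subst L'.
have L0 : L != 0.
  apply/eqP => L0; apply: par01.
  by rewrite p1E L0 /frame !scale0r !addr0 subrr /parallel /= !mul0r.
have M'0 : M' = 0.
  move: par23; rewrite p1E p2E addrC addKr opprD addrA subrr add0r.
  rewrite -[- frame _ _ _]scaleN1r frameZ parallel_frame // mul0r => /eqP.
  by rewrite mulf_eq0 (negbTE L0) mulN1r oppr_eq0 => /eqP.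
subst M'.
move: p2E; rewrite p3E -addrA frameD addr0 => p2E.
subst p1 p2 p3.
rewrite /height /foot /midline /angle /=.
have sub0 v : p0 + v - p0 = v by rewrite addrC addKr.
have sub1 u v : p0 + u - (p0 + v) = u - v by rewrite opprD addrACA subrr add0r.
have sub2 u : p0 - (p0 + u) = - u by rewrite opprD addrA subrr add0r.
have frN x y : - frame e x y = frame e (- x) (- y).
  by rewrite -scaleN1r frameZ !mulN1r.
rewrite /height /foot /angle /= in hH hA hB.
rewrite !sub0 !dot_frame // in hH hA.
rewrite sub2 frN !sub1 !frameB !dot_frame // !enorm_frame // in hB.
rewrite !enorm_frame // in hA.
rewrite sub0 sub1 frameB !enorm_frame // in lt23.
have H2 : H * H = 1.
  move: hH; rewrite frameZ sub1 frameB enorm_frame //.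
  have -> : g + M - ((g + M) * L + H * 0) / (L * L + 0 * 0) * L = 0 by field.
  have -> : H - ((g + M) * L + H * 0) / (L * L + 0 * 0) * 0 = H by field.
  rewrite mulr0 add0r -expr2 sqrtr_sqr => hn.
  by rewrite -real_normK ?num_real // hn expr1n.
have gE : g = Num.sg L.
  apply: angle45_slope L0 _.
  by rewrite -hA !mul0r !addr0 H2.
have gM : g + M - L = Num.sg (- L).
  apply: angle45_slope; first by rewrite oppr_eq0.
  by rewrite -hB oppr0 !mul0r !addr0 H2.
rewrite sgrN -gE in gM.
have ME : M = L - 2 * g by lra.
have gg : g * g = 1 by rewrite gE -expr2 sqr_sg L0.
have LE : L = g * `|L| by rewrite gE -numEsg.
have L2 : 2 < `|L|.
  rewrite ltNge; apply/negP => Lle.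
  (* the two lateral sides meet at height |L| / 2 *)
  have : (segment (p0 + frame e L 0) (p0 + frame e (g + M) H)
    `&` segment (p0 + frame e g H) p0) (p0 + frame e (g * (`|L| / 2)) (H * (`|L| / 2))).
    have ? := normr_ge0 L.
    split.
      exists (`|L| / 2); first by rewrite /= in_itv /=; apply/andP; split; lra.
      rewrite ME; move: LE; generalize `|L| => A ->.
      by rewrite /frame; case: (p0) => a b; case: (e) => u v; congr (_, _);
        rewrite /= /GRing.scale /=; field.
    exists (1 - `|L| / 2); first by rewrite /= in_itv /=; apply/andP; split; lra.
    generalize `|L| => A.
    by rewrite /frame; case: (p0) => a b; case: (e) => u v; congr (_, _);
      rewrite /= /GRing.scale /=; field.
  by rewrite seg.
rewrite /midline /= sub0 sub1 frameB !enorm_frame //.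
have -> : (g - (g + M)) * (g - (g + M)) + (H - H) * (H - H) = M ^+ 2 by ring.
have -> : L * L + 0 * 0 = L ^+ 2 by ring.
rewrite !sqrtr_sqr.
have -> : `|M| = `|L| - 2.
  have -> : M = g * (`|L| - 2) by rewrite ME {1}LE; ring.
  rewrite normrM gE normr_sg L0 mul1r ger0_norm //; lra.
set m := _ / 2.
have mE : `|L| = m + 1 by rewrite /m; field.
exists H, (p0 + frame e (g * (m + 1) / 2) 0); split => //.
  by rewrite /m; lra.
rewrite -figure_std //; last by rewrite /m; lra.
have gm : g * m = g + M by rewrite /m ME [in RHS]LE; field.
by rewrite gm -mE -LE.
Qed.

End Trapezoid45.

(** * The vertices of a tile seen by its indicator function *)

Definition tile (R : realType) (e : plane R) (k : R) (w : plane R) (m : R) :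
  set (plane R) := (fun z => k *: z + w) @` std_trapezoid e m.

Section Probe.
Variable R : realType.
Implicit Types (x y u k t q m : R) (F : R -> R -> R).

Lemma near_pos u k : 0 < k -> \forall t \near 0^'+, (0 < u + t * k) = (0 <= u).
Proof.
move=> k0; have [u0|u0] := leP 0 u.
  near=> t; rewrite ltr_wpDl // mulr_gt0 //.
near=> t; apply/negbTE; rewrite -leNgt -lerBrDl sub0r -ler_pdivlMr //.
near: t; apply: nbhs_right_le; rewrite divr_gt0 // oppr_gt0 //.
Unshelve. all: by end_near. Qed.

Lemma near_neg u k : k < 0 -> \forall t \near 0^'+, (0 < u + t * k) = (0 < u).
Proof.
move=> k0; have k0' : 0 < - k by rewrite oppr_gt0.
have [u0|u0] := ltP 0 u.
  near=> t; rewrite -[t * k]opprK -mulrN subr_gt0 -ltr_pdivlMr //.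
  near: t; apply: nbhs_right_lt; rewrite divr_gt0 //.
near=> t; apply/negbTE; rewrite -leNgt -[u in u + _]opprK addrC subr_le0.
by apply: (@le_trans _ _ 0); rewrite ?oppr_ge0 // pmulr_rle0 // ltW.
Unshelve. all: by end_near. Qed.

(** Directions and weights. The weights are chosen so that the weighted sum of
an indicator vanishes for a half-plane with boundary of slope 0, 1 or -1 through
the centre, but not at the corners of tiles. *)
Definition probes : seq ((R * R) * R) :=
  [:: ((2, 1), 1); ((2, -1), 1); ((-2, 1), 1); ((-2, -1), 1);
      ((0, 1), - 2); ((0, -1), - 2)].

Definition probe F x y t : R :=
  \sum_(d <- probes) d.2 * F (x + t * d.1.1) (y + t * d.1.2).

(** Hence homotheties with negative ratio need no separate treatment. *)
Lemma probe_opp F x y t : probe F x y (- t) = probe F x y t.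
Proof.
rewrite /probe /probes !big_cons !big_nil /= !(mulrN, mulNr, mulr0, oppr0, opprK).
by ring.
Qed.

(** A wedge bounded by the horizontal ray to the right and the ray of slope 1
is detected at its apex only. *)
Lemma probe_wedgeR x0 y0 x y k : 0 < k -> \forall t \near 0^'+,
  probe (fun x y => ((0 < y - y0) && (0 < (x - x0) - (y - y0)))%:R) x y (t * k)
  = ((x == x0) && (y == y0))%:R.
Proof.
move=> k0.
have p1 u j : 0 < j -> \forall t \near 0^'+, (0 < u + t * (k * j)) = (0 <= u).
  by move=> ?; apply: near_pos; rewrite mulr_gt0.
have n1 u j : j < 0 -> \forall t \near 0^'+, (0 < u + t * (k * j)) = (0 < u).
  by move=> ?; apply: near_neg; rewrite pmulr_rlt0.
set u := y - y0; set v := (x - x0) - u.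
near=> t; rewrite /probe /probes !big_cons !big_nil /=.
have E j : y + t * k * j - y0 = u + t * (k * j) by rewrite /u; ring.
have E2 i j : x + t * k * i - x0 - (u + t * (k * j)) = v + t * (k * (i - j)).
  by rewrite /v; ring.
rewrite !E !E2.
have -> : (0 < u + t * (k * 1)) = (0 <= u) by near: t; apply: p1; lra.
have -> : (0 < u + t * (k * -1)) = (0 < u) by near: t; apply: n1; lra.
have -> : (0 < v + t * (k * (2 - 1))) = (0 <= v) by near: t; apply: p1; lra.
have -> : (0 < v + t * (k * (2 - -1))) = (0 <= v) by near: t; apply: p1; lra.
have -> : (0 < v + t * (k * (-2 - 1))) = (0 < v) by near: t; apply: n1; lra.
have -> : (0 < v + t * (k * (-2 - -1))) = (0 < v) by near: t; apply: n1; lra.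
have -> : (0 < v + t * (k * (0 - 1))) = (0 < v) by near: t; apply: n1; lra.
have -> : (0 < v + t * (k * (0 - -1))) = (0 <= v) by near: t; apply: p1; lra.
have -> : ((x == x0) && (y == y0)) = ((u == 0) && (v == 0)).
  rewrite -(subr_eq0 y) -/u -(subr_eq0 x) /v andbC.
  by case: eqP => // ->; rewrite subr0.
by case: (ltgtP u 0) => ?; case: (ltgtP v 0) => ?; rewrite /= ; ring.
Unshelve. all: by end_near. Qed.

(** The wedge bounded by the ray of slope -1 and the horizontal ray to the
right has a corner of 135 degrees, whence the minus sign. *)
Lemma probe_wedgeL x0 y0 x y k : 0 < k -> \forall t \near 0^'+,
  probe (fun x y => ((0 < y - y0) && (0 < (x - x0) + (y - y0)))%:R) x y (t * k)
  = - ((x == x0) && (y == y0))%:R.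
Proof.
move=> k0.
have p1 u j : 0 < j -> \forall t \near 0^'+, (0 < u + t * (k * j)) = (0 <= u).
  by move=> ?; apply: near_pos; rewrite mulr_gt0.
have n1 u j : j < 0 -> \forall t \near 0^'+, (0 < u + t * (k * j)) = (0 < u).
  by move=> ?; apply: near_neg; rewrite pmulr_rlt0.
set u := y - y0; set v := (x - x0) + u.
near=> t; rewrite /probe /probes !big_cons !big_nil /=.
have E j : y + t * k * j - y0 = u + t * (k * j) by rewrite /u; ring.
have E2 i j : x + t * k * i - x0 + (u + t * (k * j)) = v + t * (k * (i + j)).
  by rewrite /v; ring.
rewrite !E !E2.
have -> : (0 < u + t * (k * 1)) = (0 <= u) by near: t; apply: p1; lra.
have -> : (0 < u + t * (k * -1)) = (0 < u) by near: t; apply: n1; lra.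
have -> : (0 < v + t * (k * (2 + 1))) = (0 <= v) by near: t; apply: p1; lra.
have -> : (0 < v + t * (k * (2 + -1))) = (0 <= v) by near: t; apply: p1; lra.
have -> : (0 < v + t * (k * (-2 + 1))) = (0 < v) by near: t; apply: n1; lra.
have -> : (0 < v + t * (k * (-2 + -1))) = (0 < v) by near: t; apply: n1; lra.
have -> : (0 < v + t * (k * (0 + 1))) = (0 <= v) by near: t; apply: p1; lra.
have -> : (0 < v + t * (k * (0 + -1))) = (0 < v) by near: t; apply: n1; lra.
have -> : ((x == x0) && (y == y0)) = ((u == 0) && (v == 0)).
  rewrite -(subr_eq0 y) -/u -(subr_eq0 x) /v andbC.
  by case: eqP => // ->; rewrite addr0.
by case: (ltgtP u 0) => ?; case: (ltgtP v 0) => ?; rewrite /= ; ring.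
Unshelve. all: by end_near. Qed.

Lemma near_neq u k c : k != 0 -> \forall t \near 0^'+, u + t * k != c.
Proof.
move=> k0; have [->|uc] := eqVneq u c; near=> t.
  by rewrite -subr_eq0 addrC addKr mulf_neq0 // gt_eqF.
have tk : `|t * k| < `|c - u|.
  rewrite normrM gtr0_norm // -ltr_pdivlMr ?normr_gt0 //.
  near: t; apply: nbhs_right_lt.
  by rewrite divr_gt0 ?normr_gt0 // subr_eq0 eq_sym.
by apply: contraTneq tk => <-; rewrite addrC addKr ltxx.
Unshelve. all: by end_near. Qed.

Lemma near_all (I : eqType) (s : seq I) (P : R -> I -> Prop) :
  (forall i, i \in s -> \forall t \near 0^'+, P t i) ->
  \forall t \near 0^'+, forall i, i \in s -> P t i.
Proof.
elim: s => [_|i s IH H]; first by near=> t.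
near=> t => j; rewrite inE => /orP [/eqP ->|js].
  by near: t; apply: H; rewrite mem_head.
by move: j js; near: t; apply: IH => j js; apply: H; rewrite inE js orbT.
Unshelve. all: by end_near. Qed.

Definition in_std m x y : bool :=
  (0 <= y <= 1) && (`|x| <= (m + 1) / 2 - y).

Definition in_std_open m x y : bool :=
  (0 < y < 1) && (`|x| < (m + 1) / 2 - y).

(** The four lines carrying the sides. *)
Definition off_sides m x y : bool :=
  [&& y != 0, y != 1, x - y != - ((m + 1) / 2) & x + y != (m + 1) / 2].

Lemma off_sides_open m x y : off_sides m x y -> in_std m x y -> in_std_open m x y.
Proof.
case/and4P=> y0 y1 xl xr /andP [/andP [yge yle]].
rewrite /in_std_open ler_norml ltr_norml => /andP [h1 h2].
have yl : 0 < y by rewrite lt_def y0.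
have yr : y < 1 by rewrite lt_def eq_sym y1.
rewrite yl yr /= !lt_neqAle h1 h2 !andbT; apply/andP; split; apply/eqP => E.
  by move/eqP: xl; apply; lra.
by move/eqP: xr; apply; lra.
Qed.

(** The points to the right of the left side form the difference of two
translates of the wedge of slope 1, those to the right of the right side the
difference of two translates of the wedge of slope -1; the trapezoid is the
difference of these two strips. *)
Lemma std_wedges m x y : 1 < m -> off_sides m x y ->
  (in_std m x y)%:R =
    ((0 < y - 0) && (0 < (x - - ((m + 1) / 2)) - (y - 0)))%:R
  - ((0 < y - 1) && (0 < (x - - ((m - 1) / 2)) - (y - 1)))%:R
  - ((0 < y - 0) && (0 < (x - (m + 1) / 2) + (y - 0)))%:R
  + ((0 < y - 1) && (0 < (x - (m - 1) / 2) + (y - 1)))%:R :> R.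
Proof.
move=> m1 /and4P [y0 y1 xl xr].
rewrite !subr0 opprK /in_std ler_norml.
have -> : x - - ((m - 1) / 2) - (y - 1) = x + (m + 1) / 2 - y by field.
have -> : x - (m - 1) / 2 + (y - 1) = x - (m + 1) / 2 + y by field.
have {}y0 : (0 <= y) = (0 < y) by rewrite lt_def y0.
have {}y1 : (y <= 1) = ~~ (0 < y - 1) by rewrite subr_gt0 -leNgt.
have {}xl : (- ((m + 1) / 2 - y) <= x) = (0 < x + (m + 1) / 2 - y).
  apply/idP/idP => h; last by lra.
  by rewrite lt_neqAle; apply/andP; split; [apply/eqP => E; move/eqP: xl; apply|]; lra.
have {}xr : (x <= (m + 1) / 2 - y) = ~~ (0 < x - (m + 1) / 2 + y).
  by rewrite -leNgt; apply/idP/idP => ?; lra.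
rewrite y0 y1 xl xr.
have [h0|h0] := ltP 0 y; have [h1|h1] := ltP 0 (y - 1);
  have [hl|hl] := ltP 0 (x + (m + 1) / 2 - y);
  have [hr|hr] := ltP 0 (x - (m + 1) / 2 + y); rewrite /= ?subr0 ?sub0r ?addr0 ?add0r //; try lra.
Qed.

Lemma near_off_sides m x y k (d : (R * R) * R) : k != 0 -> d \in probes ->
  \forall t \near 0^'+, off_sides m (x + t * k * d.1.1) (y + t * k * d.1.2).
Proof.
move=> k0 dp.
have [dy [dl dr]] : d.1.2 != 0 /\ d.1.1 - d.1.2 != 0 /\ d.1.1 + d.1.2 != 0.
  move: dp; rewrite /probes !inE.
  by do !(case/orP; first by move/eqP=> -> /=; split; [|split]; apply/eqP; lra);
    move/eqP=> -> /=; split; [|split]; apply/eqP; lra.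
near=> t; apply/and4P; split.
- by rewrite -mulrA; near: t; apply: near_neq; rewrite mulf_neq0.
- by rewrite -mulrA; near: t; apply: near_neq; rewrite mulf_neq0.
- have -> : x + t * k * d.1.1 - (y + t * k * d.1.2)
    = (x - y) + t * (k * (d.1.1 - d.1.2)) by ring.
  by near: t; apply: near_neq; rewrite mulf_neq0.
- have -> : x + t * k * d.1.1 + (y + t * k * d.1.2)
    = (x + y) + t * (k * (d.1.1 + d.1.2)) by ring.
  by near: t; apply: near_neq; rewrite mulf_neq0.
Unshelve. all: by end_near. Qed.

Lemma probe_std m x y k : 1 < m -> k != 0 -> \forall t \near 0^'+,
  probe (fun x y => (in_std m x y)%:R) x y (t * k) =
    ((x == - ((m + 1) / 2)) && (y == 0))%:R + ((x == (m + 1) / 2) && (y == 0))%:R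
  - ((x == (m - 1) / 2) && (y == 1))%:R - ((x == - ((m - 1) / 2)) && (y == 1))%:R.
Proof.
move=> m1; wlog k0 : k / 0 < k => [H k0|_].
  move: (k0); rewrite neq_lt => /orP [kn|kp]; last exact: H.
  have kp : 0 < - k by rewrite oppr_gt0.
  by near=> t; rewrite -[t * k]opprK -mulrN probe_opp; near: t; apply: H; rewrite ?oppr_eq0.
near=> t.
rewrite /probe (eq_big_seq (fun d : (R * R) * R => d.2 *
   (((0 < y + t * k * d.1.2 - 0) && (0 < (x + t * k * d.1.1 - - ((m + 1) / 2)) - (y + t * k * d.1.2 - 0)))%:R
  - ((0 < y + t * k * d.1.2 - 1) && (0 < (x + t * k * d.1.1 - - ((m - 1) / 2)) - (y + t * k * d.1.2 - 1)))%:R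
  - ((0 < y + t * k * d.1.2 - 0) && (0 < (x + t * k * d.1.1 - (m + 1) / 2) + (y + t * k * d.1.2 - 0)))%:R
  + ((0 < y + t * k * d.1.2 - 1) && (0 < (x + t * k * d.1.1 - (m - 1) / 2) + (y + t * k * d.1.2 - 1)))%:R))); last first.
  move=> d dp; rewrite -std_wedges //.
  move: d dp; near: t; apply: near_all => d dp; apply: near_off_sides => //.
  by rewrite gt_eqF.
under eq_bigr => d _ do rewrite mulrDr !mulrBr.
rewrite big_split /= !sumrB.
set A := \sum_(_ <- _) _; set B := \sum_(_ <- _) _; set C := \sum_(_ <- _) _.
set D := \sum_(_ <- _) _.
have -> : A = ((x == - ((m + 1) / 2)) && (y == 0))%:R.
  by rewrite /A; near: t; exact: (probe_wedgeR (- ((m + 1) / 2)) 0 x y k0).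
have -> : B = ((x == - ((m - 1) / 2)) && (y == 1))%:R.
  by rewrite /B; near: t; exact: (probe_wedgeR (- ((m - 1) / 2)) 1 x y k0).
have -> : C = - ((x == (m + 1) / 2) && (y == 0))%:R.
  by rewrite /C; near: t; exact: (probe_wedgeL ((m + 1) / 2) 0 x y k0).
have -> : D = - ((x == (m - 1) / 2) && (y == 1))%:R.
  by rewrite /D; near: t; exact: (probe_wedgeL ((m - 1) / 2) 1 x y k0).
by ring.
Unshelve. all: by end_near. Qed.

End Probe.
Section Vertices.
Variables (R : realType) (e : plane R).
Hypothesis e1 : dot e e = 1.
Implicit Types (k m t : R) (w z : plane R).

(** The second components are the signs with which the probes see the vertices. *)
Definition vertices k w m : seq (plane R * R) :=
  [:: (w + k *: frame e (- ((m + 1) / 2)) 0, 1);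
      (w + k *: frame e ((m + 1) / 2) 0, 1);
      (w + k *: frame e ((m - 1) / 2) 1, - 1);
      (w + k *: frame e (- ((m - 1) / 2)) 1, - 1)].

(** Coordinates of the preimage of [z] under [z' |-> k z' + w]. *)
Definition xcoord k w z : R := dot (k^-1 *: (z - w)) e.
Definition ycoord k w z : R := dot (k^-1 *: (z - w)) (perp e).

Lemma coordE k w z : k != 0 -> z = w + k *: frame e (xcoord k w z) (ycoord k w z).
Proof. by move=> k0; rewrite -frameE // scalerA divff // scale1r addrC subrK. Qed.

Lemma coord_eq k w z x y : k != 0 ->
  (z == w + k *: frame e x y) = (xcoord k w z == x) && (ycoord k w z == y).
Proof.
move=> k0; apply/eqP/andP => [->|[/eqP <- /eqP <-]]; last exact: coordE.
rewrite /xcoord /ycoord (addrC w) addrK.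
by rewrite scalerA mulVf // scale1r dot_frame_e // dot_frame_perp // !eqxx.
Qed.

Lemma tileE k w m z : k != 0 ->
  tile e k w m z <-> in_std m (xcoord k w z) (ycoord k w z).
Proof.
move=> k0; split.
  move=> [z' [yy xx] <-]; rewrite /xcoord /ycoord addrK scalerA mulVf // scale1r.
  by rewrite /in_std yy xx.
move=> /andP [yy xx]; exists (k^-1 *: (z - w)) => //=.
by rewrite scalerA divff // scale1r subrK.
Qed.

Lemma xcoord_shift k w z t i j :
  xcoord k w (z + t *: frame e i j) = xcoord k w z + t * k^-1 * i.
Proof.
by rewrite /xcoord addrAC scalerDr dotD !dotZ dot_frame_e // mulrA (mulrC t).
Qed.

Lemma ycoord_shift k w z t i j :
  ycoord k w (z + t *: frame e i j) = ycoord k w z + t * k^-1 * j.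
Proof.
by rewrite /ycoord addrAC scalerDr dotD !dotZ dot_frame_perp // mulrA (mulrC t).
Qed.

Lemma dot_coord_continuous k w (v : plane R) :
  continuous (fun z => dot (k^-1 *: (z - w)) v).
Proof.
move=> z; rewrite /dot.
apply: (@cvgD _ _ _ _ _ (fun z => k^-1 * (z.1 - w.1) * v.1)
                         (fun z => k^-1 * (z.2 - w.2) * v.2)).
  apply: cvgMr_tmp; apply: cvgMl_tmp; apply: cvgB; [exact: cvg_fst|exact: cvg_cst].
apply: cvgMr_tmp; apply: cvgMl_tmp; apply: cvgB; [exact: cvg_snd|exact: cvg_cst].
Qed.

Lemma tile_interior k w m z : k != 0 ->
  in_std_open m (xcoord k w z) (ycoord k w z) -> (tile e k w m)° z.
Proof.
move=> k0 /andP [/andP [y0 y1]]; rewrite ltr_norml => /andP [xl xr].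
have cx : xcoord k w @ z --> xcoord k w z := @dot_coord_continuous k w e z.
have cy : ycoord k w @ z --> ycoord k w z := @dot_coord_continuous k w (perp e) z.
have cD : (fun z => xcoord k w z + ycoord k w z) @ z --> xcoord k w z + ycoord k w z.
  exact: cvgD cx cy.
have cB : (fun z => xcoord k w z - ycoord k w z) @ z --> xcoord k w z - ycoord k w z.
  exact: cvgB cx cy.
have hB : - ((m + 1) / 2) < xcoord k w z - ycoord k w z by lra.
have hD : xcoord k w z + ycoord k w z < (m + 1) / 2 by lra.
rewrite /interior; near=> z'; apply/tileE => //.
rewrite /in_std ler_norml; apply/andP; split; apply/andP; split.
- by near: z'; apply: (cvgr_ge _ cy).
- by near: z'; apply: (cvgr_le _ cy).
- have : - ((m + 1) / 2) <= xcoord k w z' - ycoord k w z'.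
    by near: z'; exact: (cvgr_ge _ cB _ hB).
  lra.
have : xcoord k w z' + ycoord k w z' <= (m + 1) / 2.
  by near: z'; exact: (cvgr_le _ cD _ hD).
lra.
Unshelve. all: by end_near. Qed.

Lemma probe_tile k w m z : 1 < m -> k != 0 -> \forall t \near 0^'+,
  \sum_(d <- probes R) d.2 * `[< tile e k w m (z + t *: frame e d.1.1 d.1.2) >]%:R
  = \sum_(v <- vertices k w m) v.2 * (z == v.1)%:R.
Proof.
move=> m1 k0; near=> t.
transitivity (probe (fun x y => (in_std m x y)%:R) (xcoord k w z) (ycoord k w z) (t * k^-1)).
  apply: eq_bigr => d _; congr (_ * (nat_of_bool _)%:R).
  by rewrite -(xcoord_shift _ _ _ _ _ d.1.2) -(ycoord_shift _ _ _ _ d.1.1); apply/asboolP/idP => /tileE; apply.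
rewrite /vertices !big_cons big_nil /= !coord_eq // !mulN1r !mul1r addr0 !addrA.
by near: t; apply: probe_std; rewrite ?invr_eq0.
Unshelve. all: by end_near. Qed.

Lemma probe_interior k w m z : k != 0 -> \forall t \near 0^'+,
  forall d, d \in probes R -> tile e k w m (z + t *: frame e d.1.1 d.1.2) ->
    (tile e k w m)° (z + t *: frame e d.1.1 d.1.2).
Proof.
move=> k0; apply: near_all => d dp; near=> t => /tileE h.
apply: tile_interior => //; apply: off_sides_open (h k0).
rewrite xcoord_shift ycoord_shift; near: t.
by apply: near_off_sides; rewrite ?invr_eq0.
Unshelve. all: by end_near. Qed.

(** Close to [z] the probes avoid all the sides, so each of them lies in the
interior of at most one tile, and the indicators add up there. *)
Lemma tiling_corner n (k : 'I_n -> R) (w : 'I_n -> plane R) (m : 'I_n -> R)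
    kC wC mC :
  kC != 0 -> 1 < mC -> (forall i, k i != 0) -> (forall i, 1 < m i) ->
  (forall i j, i != j ->
     (tile e (k i) (w i) (m i))° `&` (tile e (k j) (w j) (m j))° = set0) ->
  tile e kC wC mC = \bigcup_i tile e (k i) (w i) (m i) ->
  forall z, \sum_(v <- vertices kC wC mC) v.2 * (z == v.1)%:R =
    \sum_i \sum_(v <- vertices (k i) (w i) (m i)) v.2 * (z == v.1)%:R.
Proof.
move=> kC0 mC1 k0 m1 disj cov z.
suff [t [hC hT hI]] : exists t : R,
  [/\ \sum_(d <- probes R) d.2 * `[< tile e kC wC mC (z + t *: frame e d.1.1 d.1.2) >]%:R
  = \sum_(v <- vertices kC wC mC) v.2 * (z == v.1)%:R,
   forall i, \sum_(d <- probes R) d.2 * `[< tile e (k i) (w i) (m i) (z + t *: frame e d.1.1 d.1.2) >]%:R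
  = \sum_(v <- vertices (k i) (w i) (m i)) v.2 * (z == v.1)%:R
  & forall i d, d \in probes R -> tile e (k i) (w i) (m i) (z + t *: frame e d.1.1 d.1.2) ->
    (tile e (k i) (w i) (m i))° (z + t *: frame e d.1.1 d.1.2)].
  rewrite -hC; under [RHS]eq_bigr => i _ do rewrite -hT.
  rewrite exchange_big /=; apply: eq_big_seq => d dp.
  rewrite -mulr_sumr; congr (_ * _).
  set z' := z + _.
  have [zC|zC] := asboolP (tile e kC wC mC z'); last first.
    rewrite big1 // => i _; case: asboolP => // zi; case: zC.
    by rewrite cov; exists i.
  move: (zC); rewrite cov => -[i _ zi].
  rewrite (bigD1 i) //= asboolT // big1 ?addr0 // => j ji.
  case: asboolP => // zj.
  have : ((tile e (k j) (w j) (m j))° `&` (tile e (k i) (w i) (m i))°) z'.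
    by split; apply: hI.
  by rewrite disj.
apply: (@filter_ex _ (0 : R)^'+); near=> t; split.
- by near: t; apply: probe_tile.
- by near: t; apply: filter_forall => i; apply: probe_tile.
- by near: t; apply: filter_forall => i; apply: probe_interior.
Unshelve. all: by end_near. Qed.

(** Sum the local identity [tiling_corner] over the finite set of all vertices,
with weights [g]. *)
Lemma tiling_vertices (g : plane R -> R) n (k : 'I_n -> R) (w : 'I_n -> plane R)
    (m : 'I_n -> R) kC wC mC :
  kC != 0 -> 1 < mC -> (forall i, k i != 0) -> (forall i, 1 < m i) ->
  (forall i j, i != j ->
     (tile e (k i) (w i) (m i))° `&` (tile e (k j) (w j) (m j))° = set0) ->
  tile e kC wC mC = \bigcup_i tile e (k i) (w i) (m i) ->
  \sum_(v <- vertices kC wC mC) v.2 * g v.1 =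
    \sum_i \sum_(v <- vertices (k i) (w i) (m i)) v.2 * g v.1.
Proof.
move=> kC0 mC1 k0 m1 disj cov.
have corner := tiling_corner kC0 mC1 k0 m1 disj cov.
pose S := undup (map fst (vertices kC wC mC ++
  flatten [seq vertices (k i) (w i) (m i) | i <- index_enum 'I_n])).
have spread (s : seq (plane R * R)) : {subset map fst s <= S} ->
    \sum_(v <- s) v.2 * g v.1 = \sum_(z <- S) g z * \sum_(v <- s) v.2 * (z == v.1)%:R.
  move=> sS; under [RHS]eq_bigr => z _ do rewrite mulr_sumr.
  rewrite exchange_big /=; apply: eq_big_seq => v vs.
  rewrite (bigD1_seq v.1) /= ?undup_uniq ?sS ?map_f // eqxx mulr1 mulrC.
  by rewrite big1 ?addr0 // => z /negbTE ->; rewrite !mulr0.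
rewrite spread; last by move=> z zs; rewrite mem_undup map_cat mem_cat zs.
under eq_bigr => z _ do rewrite corner mulr_sumr.
rewrite exchange_big /=; apply: eq_bigr => i _; rewrite -spread // => z.
case/mapP => v vs ->; rewrite mem_undup map_f // mem_cat; apply/orP; right.
by apply/flattenP; exists (vertices (k i) (w i) (m i)) => //; apply/mapP; exists i; rewrite ?mem_index_enum.
Qed.

End Vertices.

(** * Linear functionals over a subfield and the necessary condition *)

Section Functional.
Variables (R : realType) (K : set R).
Hypotheses (K1 : K 1) (KB : forall x y, K x -> K y -> K (x - y))
  (KM : forall x y, K x -> K y -> K (x * y)) (KV : forall x, K x -> K x^-1).
Implicit Types (x y c k v : R) (V : set R) (f : R -> R).

Let K0 : K 0. Proof. by rewrite -(subrr 1); exact: KB. Qed.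
Let KN x : K x -> K (- x). Proof. by rewrite -sub0r; exact: KB. Qed.
Let KD x y : K x -> K y -> K (x + y).
Proof. by move=> Kx Ky; rewrite -[y]opprK; apply: KB => //; exact: KN. Qed.
Let Knat n : K n%:R.
Proof. by elim: n => [|n IH]; [exact: K0|rewrite -natr1; exact: KD]. Qed.

Definition subspace V :=
  V 0 /\ forall k x y, K k -> V x -> V y -> V (k * x + y).

Definition linear_on V f :=
  forall k x y, K k -> V x -> V y -> f (k * x + y) = k * f x + f y.

(** Elements of [V + K x] have a unique expression [v + k x], so the value at
[x] is free. *)
Lemma extend_functional V f x y : subspace V -> linear_on V f -> ~ V x ->
  exists V' f', [/\ subspace V', linear_on V' f', V `<=` V', V' x &
    (forall v, V v -> f' v = f v) /\ f' x = y].
Proof.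
move=> [V0 VL] lf Vx.
pose V' : set R := [set z | exists2 k, K k & V (z - k * x)].
pose coef z := xget 0 [set k | K k /\ V (z - k * x)].
pose f' z := f (z - coef z * x) + coef z * y.
have coefE v k : V v -> K k -> coef (v + k * x) = k.
  move=> Vv Kk; rewrite /coef; case: xgetP => [k' _ [Kk' Vk']|]; last first.
    by move/(_ k); case; split; rewrite // addrK.
  apply/eqP/negPn/negP => kk; apply: Vx.
  have kk0 : k - k' != 0 by rewrite subr_eq0 eq_sym.
  have -> : x = (k - k')^-1 * ((-1) * v + (v + k * x - k' * x)) + 0 by field.
  by apply: (VL) => //; [apply/KV/KB | apply: (VL) => //; exact: KN].
have f'E v k : V v -> K k -> f' (v + k * x) = f v + k * y.
  by move=> Vv Kk; rewrite /f' coefE // addrK.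
have f'V v : V v -> f' v = f v.
  by move=> Vv; rewrite -[v in LHS]addr0 -(mul0r x) f'E // mul0r addr0.
have repr z : V' z -> exists v k, [/\ V v, K k & z = v + k * x].
  by move=> [k Kk Vz]; exists (z - k * x), k; rewrite subrK.
have f0 : f 0 = 0.
  by have := lf 1 0 0 K1 V0 V0; rewrite !mul1r addr0 -{1}[f 0]addr0 => /addrI.
exists V', f'; split.
- split; first by exists 0; rewrite // mul0r subr0.
  move=> k z z' Kk /repr [v [j [Vv Kj ->]]] /repr [v' [j' [Vv' Kj' ->]]].
  exists (k * j + j'); first by apply: KD => //; exact: KM.
  have -> : k * (v + j * x) + (v' + j' * x) - (k * j + j') * x = k * v + v' by ring.
  exact: VL.
- move=> k z z' Kk /repr [v [j [Vv Kj ->]]] /repr [v' [j' [Vv' Kj' ->]]].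
  have -> : k * (v + j * x) + (v' + j' * x) = (k * v + v') + (k * j + j') * x by ring.
  rewrite !f'E //; [|exact: VL|by apply: KD => //; exact: KM].
  by rewrite lf //; ring.
- by move=> v Vv; exists 0; rewrite // mul0r subr0.
- by exists 1; rewrite // mul1r subrr.
- by split=> //; rewrite -[x]add0r -[x in 0 + x]mul1r f'E // f0 add0r mul1r.
Qed.

Lemma extend_functional_seq (s : seq R) V f : subspace V -> linear_on V f ->
  exists V' f', [/\ subspace V', linear_on V' f', V `<=` V',
    {in s, forall x, V' x} & forall v, V v -> f' v = f v].
Proof.
move=> sV lf; elim: s => [|x s [V1 [f1 [sV1 lf1 VV1 sV1s ff1]]]].
  by exists V, f; split=> // x; rewrite in_nil.
have [Vx|Vx] := pselect (V1 x).
  by exists V1, f1; split => // y; rewrite inE => /orP [/eqP ->|/sV1s].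
have [V2 [f2 [sV2 lf2 V12 V2x [ff2 _]]]] := extend_functional 0 sV1 lf1 Vx.
exists V2, f2; split => //.
- exact: subset_trans V12.
- by move=> y; rewrite inE => /orP [/eqP ->|/sV1s /V12].
- by move=> v Vv; rewrite ff2 ?ff1 //; exact: VV1.
Qed.

(** A functional on a subspace containing the finite list [s] is enough for a
given tiling, and finitely many one-step extensions of the identity of [K]
reach it. *)
Lemma separating_functional c (s : seq R) : ~ K c ->
  exists V f, [/\ subspace V, linear_on V f, {in s, forall x, V x},
    V 1 /\ V c & f 1 = 1 /\ f c = -1].
Proof.
move=> Kc.
have sK : subspace K by split=> // k x y *; apply: KD => //; exact: KM.
have lK : linear_on K id by [].
have [V [f [sV lf KV1 Vc [fK fc]]]] := extend_functional (-1) sK lK Kc.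
have [V' [f' [sV' lf' VV' V's ff']]] := extend_functional_seq s sV lf.
exists V', f'; split => //; first by split; apply: VV' => //; exact: KV1.
by rewrite !ff' ?fc ?fK //; exact: KV1.
Qed.

Variable e : plane R.
Hypothesis e1 : dot e e = 1.

Lemma tiling_ratio n (k : 'I_n -> R) (w : 'I_n -> plane R) (m : 'I_n -> R) wC c :
  1 < c -> (forall i, k i != 0) -> (forall i, 1 < m i) -> (forall i, K (m i)) ->
  (forall i j, i != j ->
     (tile e (k i) (w i) (m i))° `&` (tile e (k j) (w j) (m j))° = set0) ->
  tile e 1 wC c = \bigcup_i tile e (k i) (w i) (m i) -> K c.
Proof.
move=> c1 k0 m1 Km disj cov; apply: contrapT => Kc.
have [V [f [[V0 VL] lf Vs [V1 Vc] [f1 fc]]]] := separating_functional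
  (dot wC e :: [seq dot (w i) e | i <- index_enum 'I_n] ++
     [seq k i | i <- index_enum 'I_n]) Kc.
have VwC : V (dot wC e) by apply: Vs; rewrite mem_head.
have Vw i : V (dot (w i) e).
  by apply: Vs; rewrite inE mem_cat; apply/orP; right; apply/orP; left;
    apply/mapP; exists i; rewrite ?mem_index_enum.
have Vk i : V (k i).
  by apply: Vs; rewrite inE mem_cat; apply/orP; right; apply/orP; right;
    apply/mapP; exists i; rewrite ?mem_index_enum.
have fcomb i j : K j -> f (dot (w i) e + k i * j) = f (dot (w i) e) + j * f (k i).
  by move=> Kj; rewrite addrC mulrC lf // addrC.
have Khalf j : K j -> K (j / 2) by move=> Kj; apply: KM => //; exact: KV.
have vertices_tile i : \sum_(v <- vertices e (k i) (w i) (m i))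
    v.2 * f (dot v.1 e) ^+ 2 = 2 * m i * f (k i) ^+ 2.
  rewrite /vertices !big_cons big_nil /= !dotD !dotZ !dot_frame_e //.
  have Kp : K ((m i + 1) / 2) by apply: Khalf; exact: KD.
  have Kq : K ((m i - 1) / 2) by apply: Khalf; exact: KB.
  rewrite !fcomb //; try exact: KN.
  by field.
have := tiling_vertices e1 (fun z => f (dot z e) ^+ 2) (oner_neq0 R) c1 k0 m1 disj cov.
under [X in _ = X -> _]eq_bigr => i _ do rewrite vertices_tile.
rewrite /vertices !big_cons big_nil /= !dotD !dotZ !dot_frame_e // !mul1r => E.
have fC (i j : R) : K i -> K j -> f (dot wC e + (i * c + j)) = f (dot wC e) - i + j.
  move=> Ki Kj.
  have Vj : V j by rewrite -[j]mulr1 -[_ * 1]addr0; exact: VL.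
  have fj : f j = j.
    have f0 : f 0 = 0.
      by have := lf 1 0 0 K1 V0 V0; rewrite !mul1r addr0 -{1}[f 0]addr0 => /addrI.
    by rewrite -[j]mulr1 -[_ * 1]addr0 lf // f1 f0.
  rewrite addrCA lf // ?fc; last by rewrite -[dot _ _]mul1r; exact: VL.
  have := lf 1 (dot wC e) j K1 VwC Vj; rewrite !mul1r => ->.
  by rewrite fj; ring.
(* the tiles have a nonnegative sum, the big trapezoid has sum -2 *)
have : \sum_i 2 * m i * f (k i) ^+ 2 >= 0.
  apply: sumr_ge0 => i _; apply: mulr_ge0; last exact: sqr_ge0.
  by have := m1 i; lra.
rewrite -E.
have K2 : K 2^-1 by exact: KV.
have -> : - ((c + 1) / 2) = (- 2^-1) * c + (- 2^-1) by field.
have -> : (c + 1) / 2 = (2^-1) * c + (2^-1) by field.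
have -> : - ((c - 1) / 2) = (- 2^-1) * c + 2^-1 by field.
have -> : (c - 1) / 2 = (2^-1) * c + (- 2^-1) by field.
rewrite !fC //; try exact: KN.
set F := f _.
have -> : (F - - 2^-1 - 2^-1) ^+ 2 + ((F - 2^-1 + 2^-1) ^+ 2 + (-1 * (F - 2^-1 - 2^-1) ^+ 2 +
   (-1 * (F - - 2^-1 + 2^-1) ^+ 2 + 0))) = - 2 by field.
by lra.
Qed.

End Functional.

(** * Tilings of parallelograms and trapezoids *)

Lemma tiled_by1 (R : realType) (P : set (set (plane R))) F : P F -> tiled_by P F.
Proof.
move=> PF; exists 1%N, (fun=> F); split=> //.
  by move=> i j; rewrite (ord1 i) (ord1 j) eqxx.
by rewrite bigcup_const //; exists ord0.
Qed.

Lemma tiled_byU (R : realType) (P : set (set (plane R))) F G :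
  tiled_by P F -> tiled_by P G -> F° `&` G° = set0 -> tiled_by P (F `|` G).
Proof.
move=> [n1 [T1 [P1 d1 ->]]] [n2 [T2 [P2 d2 ->]]] d12.
have cross i j : (T1 i)° `&` (T2 j)° = set0.
  apply/seteqP; split => // z [zi zj]; rewrite -d12; split.
    by apply: interiorS zi => x xi; exists i.
  by apply: interiorS zj => x xi; exists j.
pose T (i : 'I_(n1 + n2)) := match fintype.split i with inl j => T1 j | inr j => T2 j end.
exists (n1 + n2)%N, T; split.
- by move=> i; rewrite /T; case: splitP.
- move=> i j ij; rewrite /T; case: (split_ordP i) ij => i' ->; case: (split_ordP j) => j' ->.
  + by move=> ij; apply: d1; apply: contraNneq ij => ->.
  + by [].
  + by move=> _; rewrite setIC.
  + by move=> ij; apply: d2; apply: contraNneq ij => ->.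
- apply/seteqP; split => z.
    by case=> -[i _ zi]; [exists (lshift n2 i)|exists (rshift n1 i)];
      rewrite // /T ?(unsplitK (inl _)) ?(unsplitK (inr _)).
  by move=> [i _]; rewrite /T; case: splitP => j _ zj; [left|right]; exists j.
Qed.

(** From a common interior point one can move a little in the direction [v],
staying in both sets but leaving the line between the half-planes. *)
Lemma interior_halfplanes (R : realType) (v : plane R) (c : R) (F G : set (plane R)) :
  0 < dot v v -> (forall z, F z -> dot z v <= c) -> (forall z, G z -> c <= dot z v) ->
  F° `&` G° = set0.
Proof.
move=> v0 Fc Gc; apply/seteqP; split => // z [zF zG].
have cv : (fun t : R => z + t *: v) @ 0^'+ --> z.
  rewrite -[X in _ --> X]addr0 -(scale0r v).
  apply: cvg_at_right_filter; apply: cvgD; first exact: cvg_cst.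
  by apply: cvgZr_tmp; exact: cvg_id.
have [t [t0 tF tG]] : exists t : R, [/\ 0 < t, F (z + t *: v) & G (z + t *: v)].
  apply: (@filter_ex _ (0 : R)^'+); near=> t; split => //.
    by near: t; exact: (cv _ zF).
  by near: t; exact: (cv _ zG).
have := Fc _ tF; have := Gc _ (nbhs_singleton zG).
rewrite dotD dotZ => h1 h2.
have : 0 < t * dot v v by rewrite mulr_gt0.
by rewrite /set0 /=; lra.
Unshelve. all: by end_near. Qed.

Section Regions.
Variables (R : realType) (e : plane R).
Hypothesis e1 : dot e e = 1.
Implicit Types (s k Y h m r x : R) (w z : plane R).

Let X z : R := dot z e.
Let H z : R := dot z (perp e).

(** Cutting along lines of slope 1 or -1 and along horizontal lines only moves
the bounds in these three definitions, in which the lateral sides are given by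
their equations [x - y = s] and [x + y = k]. *)
Definition parallelogram s s' Y Y' : set (plane R) :=
  [set z | Y <= H z <= Y' /\ s <= X z - H z <= s'].
Definition trapezoid_up s k Y Y' : set (plane R) :=
  [set z | Y <= H z <= Y' /\ s <= X z - H z /\ X z + H z <= k].
Definition trapezoid_down k s Y Y' : set (plane R) :=
  [set z | Y <= H z <= Y' /\ k <= X z + H z /\ X z - H z <= s].

Lemma sep_H c F G : (forall z, F z -> H z <= c) -> (forall z, G z -> c <= H z) ->
  F° `&` G° = set0.
Proof. by apply: interior_halfplanes; rewrite frame_perp dot_frame //; lra. Qed.

Lemma dot_diag z i j : dot z (frame e i j) = X z * i + H z * j.
Proof. by rewrite {1}(frameE e1 z) dot_frame. Qed.

Lemma sep_diff c F G : (forall z, F z -> X z - H z <= c) ->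
  (forall z, G z -> c <= X z - H z) -> F° `&` G° = set0.
Proof.
move=> hF hG; apply: (@interior_halfplanes _ (frame e 1 (-1)) c).
- by rewrite dot_frame //; lra.
- by move=> z /hF; rewrite dot_diag; lra.
- by move=> z /hG; rewrite dot_diag; lra.
Qed.

Lemma sep_sum c F G : (forall z, F z -> X z + H z <= c) ->
  (forall z, G z -> c <= X z + H z) -> F° `&` G° = set0.
Proof.
move=> hF hG; apply: (@interior_halfplanes _ (frame e 1 1) c).
- by rewrite dot_frame //; lra.
- by move=> z /hF; rewrite dot_diag; lra.
- by move=> z /hG; rewrite dot_diag; lra.
Qed.

Lemma in_std_scale m k x y : 0 < k ->
  in_std m (k^-1 * x) (k^-1 * y) =
  (0 <= y <= k) && (`|x| <= (m + 1) / 2 * k - y).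
Proof.
move=> k0; have i0 : 0 < k^-1 by rewrite invr_gt0.
rewrite /in_std pmulr_rge0 // ler_pdivrMl // mulr1 normrM gtr0_norm //.
by rewrite lerBrDr -mulrDr ler_pdivrMl // mulrC lerBrDr.
Qed.

Lemma up_tile s k Y h m : 0 < h -> k - s - 2 * Y - h = m * h ->
  trapezoid_up s k Y (Y + h) = tile e h (frame e ((s + k) / 2) Y) m.
Proof.
move=> h0 E; have h00 : h != 0 by rewrite gt_eqF.
have E2 : (m + 1) / 2 * h = (k - s - 2 * Y) / 2.
  by rewrite mulrAC mulrDl -E; field.
have tE z : tile e h (frame e ((s + k) / 2) Y) m z <->
    (0 <= H z - Y <= h) && (`|X z - (s + k) / 2| <= (k - s - 2 * Y) / 2 - (H z - Y)).
  rewrite tileE // /xcoord /ycoord !dotZ !dotB dot_frame_e // dot_frame_perp //.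
  by rewrite in_std_scale // E2.
apply/seteqP; split => z.
  move=> [/andP [y0 y1] [xl xr]]; apply/tE; rewrite ler_norml.
  by apply/andP; split; apply/andP; split; lra.
by move/tE; rewrite ler_norml => /andP [/andP [? ?] /andP [? ?]];
  split; [apply/andP; split|split]; lra.
Qed.

Lemma down_tile s k Y h m : 0 < h -> s - k + 2 * Y + h = m * h ->
  trapezoid_down k s Y (Y + h) = tile e (- h) (frame e ((s + k) / 2) (Y + h)) m.
Proof.
move=> h0 E; have h00 : - h != 0 by rewrite oppr_eq0 gt_eqF.
have E2 : (m + 1) / 2 * h = (s - k + 2 * Y) / 2 + h.
  by rewrite mulrAC mulrDl -E; field.
have tE z : tile e (- h) (frame e ((s + k) / 2) (Y + h)) m z <->
    (0 <= Y + h - H z <= h) &&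
    (`|(s + k) / 2 - X z| <= (s - k + 2 * Y) / 2 + h - (Y + h - H z)).
  rewrite tileE // /xcoord /ycoord !dotZ !dotB dot_frame_e // dot_frame_perp //.
  have inv u : (- h)^-1 * u = h^-1 * - u by rewrite invrN mulNr mulrN.
  by rewrite !inv (opprB (dot z e)) (opprB (dot z (perp e))) in_std_scale // E2.
apply/seteqP; split => z.
  move=> [/andP [y0 y1] [xl xr]]; apply/tE; rewrite ler_norml.
  by apply/andP; split; apply/andP; split; lra.
by move/tE; rewrite ler_norml => /andP [/andP [? ?] /andP [? ?]];
  split; [apply/andP; split|split]; lra.
Qed.

Variable P : set (set (plane R)).

Definition tiles_ratio m := forall k w, k != 0 -> P (tile e k w m).

(** All positions and sizes are required, so that good shapes can be reused
without transporting tilings by homotheties. *)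
Definition good_par r := forall s Y h, 0 < h ->
  tiled_by P (parallelogram s (s + r * h) Y (Y + h)).

(** The line of slope -1 cuts the parallelogram into a trapezoid and the same
trapezoid upside down. *)
Lemma good_par_base m : 1 <= m -> tiles_ratio m -> good_par (m + m).
Proof.
move=> m1 Pm s Y h h0.
have [k kE] : exists k, k = s + 2 * Y + h + m * h by exists (s + 2 * Y + h + m * h).
have mh : h <= m * h by rewrite ler_peMl // ltW.
have -> : parallelogram s (s + (m + m) * h) Y (Y + h) =
    trapezoid_up s k Y (Y + h) `|` trapezoid_down k (s + (m + m) * h) Y (Y + h).
  apply/seteqP; split => z.
    move=> [/andP [? ?] /andP [? ?]].
    have [xk|xk] := leP (X z + H z) k; [left|right];
      split; [apply/andP; split|split|apply/andP; split|split]; lra.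
  by case=> -[/andP [? ?] [? ?]]; split; apply/andP; split; lra.
apply: tiled_byU; last 1 first.
- by apply: (@sep_sum k) => z [_ []].
- apply: tiled_by1; rewrite (@up_tile _ _ _ _ m) //; last by rewrite kE; ring.
  by apply: Pm; rewrite gt_eqF.
- apply: tiled_by1; rewrite (@down_tile _ _ _ _ m) //; last by rewrite kE; ring.
  by apply: Pm; rewrite oppr_eq0 gt_eqF.
Qed.

Lemma good_par_add r1 r2 : 0 <= r1 -> 0 <= r2 -> good_par r1 -> good_par r2 ->
  good_par (r1 + r2).
Proof.
move=> r10 r20 g1 g2 s Y h h0.
have h1 : 0 <= r1 * h by rewrite mulr_ge0 // ltW.
have h2 : 0 <= r2 * h by rewrite mulr_ge0 // ltW.
have -> : parallelogram s (s + (r1 + r2) * h) Y (Y + h) =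
  parallelogram s (s + r1 * h) Y (Y + h) `|` parallelogram (s + r1 * h) (s + r1 * h + r2 * h) Y (Y + h).
  rewrite mulrDl addrA; apply/seteqP; split => z.
    move=> [? /andP [? ?]].
    have [xk|xk] := leP (X z - H z) (s + r1 * h); [left|right];
      split=> //; apply/andP; split; lra.
  by case=> -[? /andP [? ?]]; split=> //; apply/andP; split; lra.
apply: tiled_byU; [exact: g1|exact: g2|].
by apply: (@sep_diff (s + r1 * h)) => z [_ /andP []].
Qed.

(** Parallelograms with a common base [y] and heights [x1 * y] and [x2 * y] are
put on top of each other. *)
Lemma good_par_stack x1 x2 : 0 < x1 -> 0 < x2 -> good_par x1^-1 -> good_par x2^-1 ->
  good_par (x1 + x2)^-1.
Proof.
move=> x10 x20 g1 g2 s Y h h0.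
have x0 : 0 < x1 + x2 by rewrite addr_gt0.
pose y := h / (x1 + x2).
have y0 : 0 < y by rewrite divr_gt0.
have h1 : 0 < x1 * y by rewrite mulr_gt0.
have h2 : 0 < x2 * y by rewrite mulr_gt0.
have hE : h = x1 * y + x2 * y by rewrite /y; field; rewrite gt_eqF.
have -> : (x1 + x2)^-1 * h = y by rewrite /y mulrC.
rewrite {1}hE addrA.
have -> : parallelogram s (s + y) Y (Y + x1 * y + x2 * y) =
  parallelogram s (s + y) Y (Y + x1 * y) `|` parallelogram s (s + y) (Y + x1 * y) (Y + x1 * y + x2 * y).
  apply/seteqP; split => z.
    move=> [/andP [? ?] ?].
    have [xk|xk] := leP (H z) (Y + x1 * y); [left|right];
      split=> //; apply/andP; split; lra.
  by case=> -[/andP [? ?] ?]; split=> //; apply/andP; split; lra.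
apply: tiled_byU.
- by have := g1 s Y _ h1; rewrite mulKf // gt_eqF.
- by have := g2 s (Y + x1 * y) _ h2; rewrite mulKf // gt_eqF.
- by apply: (@sep_H (Y + x1 * y)) => z [/andP []].
Qed.

Lemma good_par_muln r n : 0 < r -> good_par r -> good_par (n.+1%:R * r).
Proof.
move=> r0 g; elim: n => [|n IH]; first by rewrite mul1r.
rewrite -[n.+2%:R]natr1 mulrDl mul1r; apply: good_par_add => //; last exact: ltW.
by rewrite mulr_ge0 // ltW.
Qed.

Lemma good_par_divn r n : 0 < r -> good_par r -> good_par (r / n.+1%:R).
Proof.
move=> r0 g; rewrite -[r]invrK -invfM mulrC.
have x0 : 0 < r^-1 by rewrite invr_gt0.
elim: n => [|n IH]; first by rewrite mul1r invrK.
rewrite -[n.+2%:R]natr1 mulrDl mul1r; apply: good_par_stack; rewrite ?invrK //.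
by rewrite mulr_gt0.
Qed.

Lemma good_par_ratr r (q : rat) : 0 < r -> 0 < q -> good_par r ->
  good_par (ratr q * r).
Proof.
move=> r0 q0 g.
have [n nE] : exists n : nat, numq q = n.+1%:Z.
  have : 0 < numq q by rewrite numq_gt0.
  by case: (numq q) => [[|n]|n] // _; exists n.
have [d dE] : exists d : nat, denq q = d.+1%:Z.
  have := denq_gt0 q.
  by case: (denq q) => [[|n']|n'] // _; exists n'.
rewrite /ratr nE dE mulrAC; apply: good_par_divn; first by rewrite mulr_gt0.
exact: good_par_muln.
Qed.

(** Cut off a parallelogram of ratio [r] along a line of slope 1. *)
Lemma tiled_up s k Y h m r : 0 < h -> 1 <= m -> 0 <= r -> tiles_ratio m ->
  good_par r -> k - s - 2 * Y - h = (m + r) * h -> tiled_by P (trapezoid_up s k Y (Y + h)).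
Proof.
move=> h0 m1 r0 Pm g E.
have mh : h <= m * h by rewrite ler_peMl // ltW.
have rh : 0 <= r * h by rewrite mulr_ge0 // ltW.
rewrite mulrDl in E.
have -> : trapezoid_up s k Y (Y + h) = parallelogram s (s + r * h) Y (Y + h) `|` trapezoid_up (s + r * h) k Y (Y + h).
  apply/seteqP; split => z.
    move=> [yy [? ?]].
    have [xk|xk] := leP (X z - H z) (s + r * h); [left|right];
      split=> //; first (by apply/andP); split; lra.
  by case=> -[/andP [? ?]]; [case/andP|case] => ? ?; split; [apply/andP| |apply/andP|]; split; lra.
apply: tiled_byU; [exact: g| |].
  apply: tiled_by1; rewrite (@up_tile _ _ _ _ m) //; last by lra.
  by apply: Pm; rewrite gt_eqF.
apply: (@sep_diff (s + r * h)); first by move=> z [_ /andP []].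
by move=> z [_ []].
Qed.

Lemma tiled_strips n s k Y h : 0 < h ->
  (forall i : nat, (i <= n)%N -> tiled_by P (trapezoid_up s k (Y + i%:R * h) (Y + i%:R * h + h))) ->
  tiled_by P (trapezoid_up s k Y (Y + n.+1%:R * h)).
Proof.
move=> h0; elim: n => [|n IH] strips.
  by have := strips 0%N isT; rewrite mul0r addr0 mul1r.
have nh : 0 <= n.+1%:R * h by rewrite mulr_ge0 // ltW.
have -> : trapezoid_up s k Y (Y + n.+2%:R * h) = trapezoid_up s k Y (Y + n.+1%:R * h) `|`
   trapezoid_up s k (Y + n.+1%:R * h) (Y + n.+1%:R * h + h).
  rewrite -[n.+2%:R]natr1 mulrDl mul1r addrA; apply/seteqP; split => z.
    move=> [/andP [? ?] ?].
    have [xk|xk] := leP (H z) (Y + n.+1%:R * h); [left|right];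
      split=> //; apply/andP; split; lra.
  by case=> -[/andP [? ?] ?]; split=> //; apply/andP; split; lra.
apply: tiled_byU.
- by apply: IH => i ni; apply: strips; apply: leqW.
- exact: strips.
- by apply: (@sep_H (Y + n.+1%:R * h)) => z [/andP []].
Qed.

(** Of the [n + 1] equal horizontal strips, the one with number [i] is a
trapezoid whose midline is [(n + 1) (c + 1) - 2 i - 1] times its height. The
smallest of these ratios, for [i = n], is [(n + 1) (c - 1) + 1], which exceeds
[a] for large [n]. *)
Lemma tiled_tile (a c : R) w : 1 < a -> 1 < c -> tiles_ratio a ->
  (forall n i : nat, (i <= n)%N -> 0 < n.+1%:R * (c + 1) - 2 * i%:R - 1 - a ->
     good_par (n.+1%:R * (c + 1) - 2 * i%:R - 1 - a)) ->
  tiled_by P (tile e 1 w c).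
Proof.
move=> a1 c1 Pa g.
have [n nE] : exists n : nat, a - 1 < n.+1%:R * (c - 1).
  exists (Num.bound ((a - 1) / (c - 1))).
  rewrite -ltr_pdivrMr ?subr_gt0 //.
  apply: lt_le_trans (archi_boundP _) _; last by rewrite ler_nat.
  by rewrite divr_ge0 //; lra.
pose s := X w - (c + 1) / 2 - H w; pose k := X w + (c + 1) / 2 + H w.
have -> : tile e 1 w c = trapezoid_up s k (H w) (H w + 1).
  rewrite (@up_tile _ _ _ _ c) ?ltr01 //; last by rewrite /s /k; field.
  by congr tile; rewrite {1}(frameE e1 w) /s /k; congr frame; rewrite /X /H; field.
pose N : R := n.+1%:R.
have N0 : 0 < N by rewrite /N.
have -> : H w + 1 = H w + N * N^-1 by rewrite divff // gt_eqF.
apply: tiled_strips => [|i ni]; first by rewrite invr_gt0.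
have iN : i%:R <= N - 1.
  by rewrite /N -natr1 addrK ler_nat.
have r0 : 0 < N * (c + 1) - 2 * i%:R - 1 - a by rewrite /N; nra.
apply: (@tiled_up _ _ _ _ a (N * (c + 1) - 2 * i%:R - 1 - a)).
- by rewrite invr_gt0.
- exact: ltW.
- exact: ltW.
- exact: Pa.
- exact: g.
- by rewrite /s /k; field; rewrite gt_eqF.
Qed.

End Regions.

(** * The quadratic field *)

Section QuadraticField.
Variables (R : realType) (d : rat).
Hypothesis d_gt0 : 0 < d.
Hypothesis irr : forall r : rat, Num.sqrt (ratr d) <> ratr r :> R.
Implicit Types (u v : rat) (x y : R).

Let S : R := Num.sqrt (ratr d).

Let S2 : S * S = ratr d.
Proof. by rewrite -expr2 sqr_sqrtr // ler0q ltW. Qed.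

Let S_gt0 : 0 < S. Proof. by rewrite sqrtr_gt0 ltr0q. Qed.

Definition quad_elt u v : R := ratr u + ratr v * S.
Definition quad_conj u v : R := ratr u - ratr v * S.

Lemma quad_elt_eq0 u v : quad_elt u v = 0 -> u = 0 /\ v = 0.
Proof.
move=> h; have [v0|v0] := eqVneq v 0.
  by move: h; rewrite /quad_elt v0 rmorph0 mul0r addr0 => /eqP; rewrite fmorph_eq0 => /eqP.
exfalso; apply: (irr (r := - u / v)).
rewrite fmorph_div rmorphN /=; apply: (mulfI (x := ratr v)); first by rewrite fmorph_eq0.
by rewrite mulrCA divff ?fmorph_eq0 // mulr1; apply/eqP; rewrite -subr_eq0 opprK addrC -/S -/(quad_elt u v) h.
Qed.

Lemma quad_conjE u v : quad_conj u v = quad_elt u (- v).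
Proof. by rewrite /quad_elt /quad_conj rmorphN mulNr. Qed.

Lemma quad_elt_mul u v u' v' :
  quad_elt u v * quad_elt u' v' = quad_elt (u * u' + d * (v * v')) (u * v' + v * u').
Proof.
rewrite /quad_elt !rmorphD !rmorphM /= -S2; ring.
Qed.

(** Inversion commutes with conjugation: both inverses have denominator the
norm [u ^ 2 - d v ^ 2]. *)
Lemma quad_elt_inv u v : quad_elt u v != 0 ->
  exists u' v', (quad_elt u v)^-1 = quad_elt u' v' /\ (quad_conj u v)^-1 = quad_conj u' v'.
Proof.
move=> x0.
have c0 : quad_conj u v != 0.
  apply: contra_neq x0; rewrite quad_conjE => /quad_elt_eq0 [-> /eqP]; rewrite oppr_eq0 => /eqP ->.
  by rewrite /quad_elt !rmorph0 mul0r addr0.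
have nE : ratr (u * u - d * (v * v)) = quad_elt u v * quad_conj u v :> R.
  by rewrite rmorphB !rmorphM /= /quad_elt /quad_conj -S2; ring.
exists (u / (u * u - d * (v * v))), (- v / (u * u - d * (v * v))).
have numZ (q p r : rat) : quad_elt (q / r) (p / r) = quad_elt q p / ratr r.
  by rewrite /quad_elt !fmorph_div /=; ring.
split; first by rewrite numZ nE -quad_conjE; field; rewrite c0.
by rewrite [RHS]quad_conjE [- v / _]mulNr opprK numZ nE; field; rewrite c0.
Qed.

Lemma quadfield1 : quadfield d (1 : R).
Proof. by exists 1, 0; rewrite rmorph1 rmorph0 mul0r addr0. Qed.

Lemma quadfieldB x y : quadfield d x -> quadfield d y -> quadfield d (x - y).
Proof.
move=> [u [v ->]] [u' [v' ->]]; exists (u - u'), (v - v').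
by rewrite !rmorphB /=; ring.
Qed.

Lemma quadfieldM x y : quadfield d x -> quadfield d y -> quadfield d (x * y).
Proof.
by move=> [u [v ->]] [u' [v' ->]]; do 2 eexists; exact: quad_elt_mul.
Qed.

Lemma quadfieldV x : quadfield d x -> quadfield d x^-1.
Proof.
have [->|x0] := eqVneq x 0; first by rewrite invr0.
move=> [u [v xE]]; move: x0; rewrite xE => /quad_elt_inv [u' [v' [E _]]].
by exists u', v'.
Qed.

(** Take [v = - n] and approximate [n * sqrt d] by a rational [u]. *)
Lemma quad_elt_approx (eps N : R) : 0 < eps ->
  exists u v, `|quad_elt u v| < eps /\ N < quad_conj u v.
Proof.
move=> eps0; pose n := Num.bound (`|N| / S).
have nN : N < n%:R * S.
  apply: le_lt_trans (ler_norm _) _; rewrite -ltr_pdivrMr //.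
  by apply: archi_boundP; rewrite divr_ge0 // ltW.
have [q] : exists q : rat, ratr q \in `]n%:R * S, n%:R * S + eps[.
  by apply: rat_in_itvoo; rewrite ltrDl.
rewrite in_itv /= => /andP [q1 q2].
have nS : 0 <= n%:R * S by rewrite mulr_ge0 // ltW.
exists q, (- n%:R); rewrite /quad_elt /quad_conj rmorphN /= ratr_nat mulNr opprK; split.
  by rewrite ltr_norml; apply/andP; split; lra.
by lra.
Qed.

Variables ua va ub vb : rat.
Let a := quad_elt ua va.
Let b := quad_elt ub vb.
Let a' := quad_conj ua va.
Let b' := quad_conj ub vb.
Hypotheses (a0 : 0 < a) (b0 : 0 < b) (a'0 : 0 < a') (b'0 : b' < 0).

(** Cramer's rule: the hypotheses are the signs of the two numerators, and
all three determinants over [rat] are, up to the factor [- 2 * sqrt d],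
determinants of numbers and their conjugates. *)
Lemma quad_elt_cone u v : b' * quad_elt u v < quad_conj u v * b -> a * quad_conj u v < a' * quad_elt u v ->
  exists p q : rat, [/\ 0 < p, 0 < q & quad_elt u v = ratr p * a + ratr q * b].
Proof.
move=> hb ha.
have det (x y z t : rat) : quad_elt x y * quad_conj z t - quad_conj x y * quad_elt z t < 0 -> 0 < x * t - y * z.
  have -> : quad_elt x y * quad_conj z t - quad_conj x y * quad_elt z t = - (2 * S) * ratr (x * t - y * z).
    by rewrite rmorphB !rmorphM /= /quad_elt /quad_conj; ring.
  rewrite mulNr oppr_lt0 pmulr_rgt0 ?ltr0q // mulr_gt0 //.
have D0 : 0 < ua * vb - va * ub.
  apply: det; rewrite -/a -/b -/a' -/b' subr_lt0.
  by apply: (@lt_trans _ _ 0); [rewrite pmulr_rlt0|rewrite mulr_gt0].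
have p0 : 0 < u * vb - v * ub by apply: det; rewrite -/b -/b' subr_lt0 [quad_elt _ _ * _]mulrC.
have q0 : 0 < ua * v - va * u by apply: det; rewrite -/a -/a' subr_lt0.
have [p [q [{}p0 {}q0 uE vE]]] : exists p q : rat,
    [/\ 0 < p, 0 < q, u = p * ua + q * ub & v = p * va + q * vb].
  exists ((u * vb - v * ub) / (ua * vb - va * ub)).
  exists ((ua * v - va * u) / (ua * vb - va * ub)).
  by split; rewrite ?divr_gt0 //; field; rewrite gt_eqF.
exists p, q; split => //; rewrite uE vE /a /b /quad_elt !rmorphD !rmorphM /=; ring.
Qed.

Variable G : R -> Prop.
Hypothesis G_add : forall r1 r2, 0 <= r1 -> 0 <= r2 -> G r1 -> G r2 -> G (r1 + r2).
Hypothesis G_stack : forall x1 x2, 0 < x1 -> 0 < x2 -> G x1^-1 -> G x2^-1 ->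
  G (x1 + x2)^-1.
Hypothesis G_ratr : forall r (q : rat), 0 < r -> 0 < q -> G r -> G (ratr q * r).
Hypotheses (Ga : G (a + a)) (Gb : G (b + b)).

Lemma good_cone u v : b' * quad_elt u v < quad_conj u v * b -> a * quad_conj u v < a' * quad_elt u v ->
  G (quad_elt u v).
Proof.
move=> hb ha; have [p [q [p0 q0 ->]]] := quad_elt_cone hb ha.
have half (r : rat) x : ratr r * x = ratr (r / 2) * (x + x).
  by rewrite fmorph_div /= ratr_nat; field.
apply: G_add.
- by rewrite mulr_ge0 ?ler0q // ltW.
- by rewrite mulr_ge0 ?ler0q // ltW.
- by rewrite half; apply: G_ratr => //; rewrite ?divr_gt0 // addr_gt0.
- by rewrite half; apply: G_ratr => //; rewrite ?divr_gt0 // addr_gt0.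
Qed.

(** The inverse [x] of [r] is written [(x / 2 + z) + (x / 2 - z)] with [z]
small and [conj z] huge, so that the two terms are positive and their
conjugates are huge, of opposite signs; their inverses then lie in the cone of
[a] and [b]. *)
Lemma good_all r : quadfield d r -> 0 < r -> G r.
Proof.
move=> Kr r0.
have [ux [vx xE]] := quadfieldV Kr; rewrite -/(quad_elt ux vx) in xE.
pose x := r^-1; pose x' := quad_conj ux vx.
have x0 : 0 < x by rewrite invr_gt0.
have A0 : 0 < x * a / a' by rewrite divr_gt0 // mulr_gt0.
have B0 : 0 < x * b / (- b') by rewrite divr_gt0 ?oppr_gt0 // mulr_gt0.
(* the bound on conj z is what good_cone requires of each of the two terms *)
have [uz [vz [zs zl]]] := @quad_elt_approx (x / 2) (`|x'| + x * a / a' + x * b / (- b'))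
  (divr_gt0 x0 (ltr0n _ 2)).
set z := quad_elt uz vz in zs; set z' := quad_conj uz vz in zl.
have /andP [zs1 zs2] : - (x / 2) < z < x / 2 by rewrite -ltr_norml.
have /andP [xl1 xl2] : - `|x'| <= x' <= `|x'| by rewrite -ler_norml.
have hA : x * a / a' * a' = x * a by rewrite divfK // gt_eqF.
have hB : x * b / (- b') * (- b') = x * b by rewrite divfK // oppr_eq0 lt_eqF.
set A := x * a / a' in hA A0 zl; set B := x * b / (- b') in hB B0 zl.
have E1 : quad_elt (ux / 2 + uz) (vx / 2 + vz) = x / 2 + z.
  by rewrite /x xE /z /quad_elt !rmorphD !fmorph_div /= !ratr_nat; field.
have E1' : quad_conj (ux / 2 + uz) (vx / 2 + vz) = x' / 2 + z'.
  by rewrite /x' /z' /quad_conj !rmorphD !fmorph_div /= !ratr_nat; field.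
have E2 : quad_elt (ux / 2 - uz) (vx / 2 - vz) = x / 2 - z.
  by rewrite /x xE /z /quad_elt !rmorphB !fmorph_div /= !ratr_nat; field.
have E2' : quad_conj (ux / 2 - uz) (vx / 2 - vz) = x' / 2 - z'.
  by rewrite /x' /z' /quad_conj !rmorphB !fmorph_div /= !ratr_nat; field.
rewrite -[r]invrK -/x; have -> : x = (x / 2 + z) + (x / 2 - z) by field.
set x1 := x / 2 + z in E1 *; set x2 := x / 2 - z in E2 *.
have x10 : 0 < x1 by rewrite /x1; lra.
have x20 : 0 < x2 by rewrite /x2; lra.
have x1x : x1 < x by rewrite /x1; lra.
have x2x : x2 < x by rewrite /x2; lra.
set x1' := x' / 2 + z' in E1'; set x2' := x' / 2 - z' in E2'.
have x1A : A < x1' by rewrite /x1'; lra.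
have x2B : x2' < - B by rewrite /x2'; lra.
apply: G_stack => //.
- have [|u [v [Ei Ei']]] := @quad_elt_inv (ux / 2 + uz) (vx / 2 + vz).
    by rewrite E1 gt_eqF.
  rewrite E1 in Ei; rewrite E1' in Ei'.
  have x1'0 : 0 < x1' by lra.
  have i0 : 0 < x1^-1 by rewrite invr_gt0.
  have i'0 : 0 < x1'^-1 by rewrite invr_gt0.
  rewrite Ei; apply: good_cone; rewrite -Ei -Ei'.
    by apply: (@lt_trans _ _ 0); [rewrite nmulr_rlt0|rewrite mulr_gt0].
  rewrite ltr_pdivrMr // mulrAC ltr_pdivlMr //.
  apply: (@lt_trans _ _ (x * a)); first by rewrite mulrC ltr_pM2r.
  by rewrite -hA mulrC ltr_pM2l.
- have [|u [v [Ei Ei']]] := @quad_elt_inv (ux / 2 - uz) (vx / 2 - vz).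
    by rewrite E2 gt_eqF.
  rewrite E2 in Ei; rewrite E2' in Ei'.
  have x2'0 : x2' < 0 by lra.
  have i0 : 0 < x2^-1 by rewrite invr_gt0.
  have i'0 : x2'^-1 < 0 by rewrite invr_lt0.
  rewrite Ei; apply: good_cone; rewrite -Ei -Ei'; last first.
    by apply: (@lt_trans _ _ 0); [rewrite pmulr_rlt0|rewrite mulr_gt0].
  rewrite ltr_pdivrMr // -mulrA ltr_ndivlMl // -[x2' * b']mulrNN.
  apply: (@lt_trans _ _ (x * b)); first by rewrite mulrC ltr_pM2r.
  by rewrite -hB ltr_pM2r ?oppr_gt0 // ltrNr.
Qed.

End QuadraticField.

(** * The equivalence *)

Lemma homothetic_tile (R : realType) (e : plane R) (k k0 : R) (w w0 : plane R) (m : R) :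
  k != 0 -> k0 != 0 -> homothetic (tile e k w m) (tile e k0 w0 m).
Proof.
move=> kn0 k0n0; exists (k / k0), (w - (k / k0) *: w0); split.
  by rewrite mulf_neq0 // invr_eq0.
rewrite /tile image_comp; apply: eq_imagel => z _ /=.
by rewrite scalerDr scalerA divfK // -addrA [_ *: w0 + _]addrCA subrr addr0.
Qed.

Lemma homothetic_tileE (R : realType) (e : plane R) (k0 : R) (w0 : plane R) (m : R) F :
  k0 != 0 -> homothetic F (tile e k0 w0 m) ->
  exists (k : R) (w : plane R), k != 0 /\ F = tile e k w m.
Proof.
move=> k0n0 [k [w [k_neq0 ->]]]; exists (k * k0), (k *: w0 + w); split.
  by rewrite mulf_neq0.
rewrite /tile image_comp; apply: eq_imagel => z _ /=.
by rewrite scalerDr scalerA addrA.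
Qed.

(** Reversing the frame rotates the normal trapezoid by 180 degrees. *)
Lemma tileN (R : realType) (e : plane R) (k : R) (w : plane R) (m : R) :
  tile e (- k) w m = tile (- e) k w m.
Proof.
have dotN (z u : plane R) : dot (- z) u = - dot z u by rewrite -scaleN1r dotZ mulN1r.
have dotNr (z u : plane R) : dot z (- u) = - dot z u by rewrite /dot /=; ring.
have perpN : perp (- e) = - perp e by [].
have stdN (u z : plane R) : std_trapezoid u m z -> std_trapezoid (- u) m (- z).
  rewrite /std_trapezoid /=; have -> : perp (- u) = - perp u by [].
  by rewrite !dotN !dotNr !opprK.
apply/seteqP; split => _ [z zs <-]; exists (- z); rewrite ?scaleNr ?scalerN ?opprK //.
  exact: stdN.
by rewrite -[e]opprK; exact: stdN.
Qed.

(** The orientation of the frame is chosen so that the given trapezoid is a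
translate of the normal one. *)
Lemma exists_frame (R : realType) (l : plane R) (C : vertices4 R) :
  l != 0 -> trapezoid45 l C ->
  exists (e w : plane R) (k : R), [/\ dot e e = 1, k != 0, l = k *: e,
    1 < midline C & figure C = tile e 1 w (midline C)].
Proof.
move=> l0 trapC.
have ll : 0 < dot l l.
  move: l0; case: l trapC => l1 l2 _ l0; rewrite lt_def /dot /= addr_ge0 -?expr2 ?sqr_ge0 //.
  rewrite andbT; apply: contra l0; rewrite paddr_eq0 ?sqr_ge0 // !sqrf_eq0.
  by move=> /andP [/eqP -> /eqP ->].
have n0 : 0 < enorm l by rewrite sqrtr_gt0.
have n2 : enorm l * enorm l = dot l l by rewrite -expr2 sqr_sqrtr // ltW.
pose e := (enorm l)^-1 *: l.
have e1 : dot e e = 1.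
  have -> : dot e e = dot l l / (enorm l * enorm l).
    by rewrite /e /dot /= /GRing.scale /=; field; rewrite gt_eqF.
  by rewrite n2 divff // gt_eqF.
have le : l = enorm l *: e by rewrite scalerA divff ?scale1r // gt_eqF.
have nn0 : enorm l != 0 by rewrite gt_eqF.
have [s [w [s2 c1 Cs]]] := trapezoid45_std e1 nn0 le trapC.
move/eqP: s2; rewrite sqrf_eq1 => /orP [] /eqP sE.
  by exists e, w, (enorm l); split => //; rewrite Cs sE.
exists (- e), w, (- enorm l); split => //.
- by rewrite -e1 /dot /=; ring.
- by rewrite oppr_eq0.
- by rewrite scalerN scaleNr opprK.
- by rewrite -tileN Cs sE.
Qed.

Unset Implicit Arguments.

Theorem mainTheorem2 (R : realType) (d : rat) (d_gt0 : 0 < d)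
  (sqrtd_irrational : forall r : rat, Num.sqrt (ratr d) <> ratr r :> R)
  (l : plane R) (l_neq0 : l != 0)
  (A B C : vertices4 R)
  (trapA : trapezoid45 l A) (trapB : trapezoid45 l B) (trapC : trapezoid45 l C)
  (a b c : R)
  (midA : midline A = a) (midB : midline B = b) (midC : midline C = c)
  (a_quad : quadfield d a) (b_quad : quadfield d b)
  (conja_gt0 : 0 < quadconj d a) (conjb_lt0 : quadconj d b < 0) :
  tiled_by [set F | homothetic F (figure A) \/ homothetic F (figure B)]
           (figure C)
  <-> quadfield d c.
Proof.
have [e [wC [k [e1 k0 le c1 ->]]]] := exists_frame l_neq0 trapC.
have [sA [wA [sA2 a1 ->]]] := trapezoid45_std e1 k0 le trapA.
have [sB [wB [sB2 b1 ->]]] := trapezoid45_std e1 k0 le trapB.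
rewrite -!/(tile _ _ _ _).
rewrite midA midB midC in a1 b1 c1 *.
have sqr1_neq0 (s : R) : s ^+ 2 = 1 -> s != 0.
  by move=> s2; rewrite -sqrf_eq0 s2 oner_neq0.
have {sA2} sA0 := sqr1_neq0 _ sA2.
have {sB2} sB0 := sqr1_neq0 _ sB2.
have K1 := quadfield1 R d.
have KB := @quadfieldB R d.
have KM := @quadfieldM R d d_gt0.
have KV := @quadfieldV R d d_gt0 sqrtd_irrational.
split.
  move=> [n [T [PT disj cov]]].
  have /choice [p pT] i : exists p : R * plane R * R, [/\ p.1.1 != 0, 1 < p.2,
      quadfield d p.2 & T i = tile e p.1.1 p.1.2 p.2].
    case: (PT i) => /homothetic_tileE [] // k' [w' [k'0 ->]].
      by exists (k', w', a).
    by exists (k', w', b).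
  apply: (tiling_ratio K1 KB KM KV e1 (k := fun i => (p i).1.1)
    (w := fun i => (p i).1.2) (m := fun i => (p i).2) (wC := wC)) => //.
  - by move=> i; case: (pT i).
  - by move=> i; case: (pT i).
  - by move=> i; case: (pT i).
  - move=> i j ij; case: (pT i) => _ _ _ <-; case: (pT j) => _ _ _ <-.
    exact: disj.
  - by rewrite cov; apply: eq_bigcupr => i _; case: (pT i).
move=> Kc.
set P : set (set (plane R)) := (P in tiled_by P _).

have Pa : tiles_ratio e P a by move=> k' w' k'0; left; exact: homothetic_tile.
have Pb : tiles_ratio e P b by move=> k' w' k'0; right; exact: homothetic_tile.
apply: (tiled_tile e1 wC a1 c1 Pa) => n i _ r0.
have Knat j : quadfield d (j%:R : R).
  by exists j%:R, 0; rewrite ratr_nat rmorph0 mul0r addr0.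
have KD x y : quadfield d x -> quadfield d y -> quadfield d (x + y : R).
  by move=> Kx Ky; rewrite -[y]opprK -[- y]sub0r; do 2 (apply: (KB) => //); exact: (Knat 0%N).
have [ua [va aE]] := a_quad; have [ub [vb bE]] := b_quad.
have aN : quad_elt R d ua va = a by rewrite aE.
have bN : quad_elt R d ub vb = b by rewrite bE.
have a'0 : 0 < quad_conj R d ua va by move: conja_gt0; rewrite aE quadconjE.
have b'0 : quad_conj R d ub vb < 0 by move: conjb_lt0; rewrite bE quadconjE.
apply: (good_all d_gt0 sqrtd_irrational (ua := ua) (va := va) (ub := ub) (vb := vb)) => //.
- by rewrite aN; lra.
- by rewrite bN; lra.
- exact: good_par_add.
- exact: good_par_stack.
- by move=> r q r_gt0 q_gt0; exact: good_par_ratr.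
- by rewrite aN; apply: good_par_base => //; exact: ltW.
- by rewrite bN; apply: good_par_base => //; exact: ltW.
by do ?[apply: (KB) | apply: (KM) | apply: (KD)] => //; exact: Knat.
Qed.
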